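(* Let $\lambda=(\lambda_1\ge\cdots\ge\lambda_k\ge 0)$ be a partition of $n$, written with $k$ parts where $k$ is at least the number of rows of $\lambda$, and put $l_1=\lambda_1+k-1,\ l_2=\lambda_2+k-2,\ \dots,\ l_k=\lambda_k$. Then for every $r\ge0$ the multiplicity $m_{\lambda,r}$ of the irreducible representation of $S_n$ indexed by $\lambda$ in the degree-$r$ component $(Q_n)_{[r]}$ is $$m_{\lambda,r}=\left[\frac1{n!}\sum_{j\ \text{partition of }n}\chi_\lambda(C_j)\,|\mathcal C(j)|\,Tr_{(j)}\right]_{(l_1,\dots,l_k,r)},$$ where in the bracket $\chi_\lambda(C_j)$ stands for the Frobenius polynomial $\Delta(x)\prod_{q\ge1}P_q(x)^{j_q}$, and $[\,\cdot\,]_{(l_1,\dots,l_k,r)}$ denotes the coefficient of $x_1^{l_1}\cdots x_k^{l_k}t^r$.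
   Context: Let $F$ be a base field of characteristic $0$. $Q_n$ is the associative unital $F$-algebra generated by $v_A$ for nonempty $A\subseteq\{1,\dots,n\}$ (with $v_\emptyset:=0$), with relations $v_A(v_{A\setminus i}-v_{A\setminus j})-v_{A\setminus i}^2+v_{A\setminus j}^2+(v_{A\setminus i}-v_{A\setminus j})v_{A\setminus\{i,j\}}=0$ for all $A$ with $|A|\ge2$ and distinct $i,j\in A$; it is graded by word length, $Q_n=\bigoplus_i(Q_n)_{[i]}$, and $S_n$ acts by graded automorphisms via $\sigma(v_A)=v_{\sigma(A)}$. For a partition $j$ of $n$, $j_q$ is the number of parts equal to $q$, $C_j$ is a permutation of cycle type $j$, $\mathcal C(j)$ is the conjugacy class of permutations of cycle type $j$, and $Tr_{(j)}=Tr_{(j)}(t)=\sum_i\mathrm{Tr}(\sigma|_{(Q_n)_{[i]}})t^i$ for any $\sigma$ of cycle type $j$. In variables $x_1,\dots,x_k$: $\Delta(x)=\prod_{p<q}(x_p-x_q)$ and $P_q(x)=x_1^q+\cdots+x_k^q$. Irreducible representations of $S_n$ are indexed by partitions of $n$ in the usual way; by Frobenius' formula the character value $\chi_\lambda(C_j)$ is the coefficient of $x_1^{l_1}\cdots x_k^{l_k}$ in $\Delta(x)\prod_qP_q(x)^{j_q}$. *)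

(* Defs.v *)
From Stdlib Require Import ClassicalEpsilon.
From HB Require Import structures.
From mathcomp Require Import all_boot all_order all_algebra all_fingroup.
From mathcomp Require Import all_character.
From mathcomp Require Import generic_quotient ring_quotient mpoly.
From mathcomp Require monalg.

Set Implicit Arguments.
Unset Strict Implicit.
Unset Printing Implicit Defensive.

Import GRing.Theory.

Local Open Scope ring_scope.

Definition Qrel (n : nat) (R : nzRingType) (v : {set 'I_n} -> R)
    (A : {set 'I_n}) (i j : 'I_n) : R :=
  v A * (v (A :\ i) - v (A :\ j)) - v (A :\ i) ^+ 2 + v (A :\ j) ^+ 2
  + (v (A :\ i) - v (A :\ j)) * v (A :\ i :\ j).

Lemma eq_Qrel n (R : nzRingType) (v v' : {set 'I_n} -> R) A i j :
  v =1 v' -> Qrel v A i j = Qrel v' A i j.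
Proof. by move=> e; rewrite /Qrel !e. Qed.

Lemma Qrel_morph n (R S : nzRingType) (e : {rmorphism R -> S})
  (v : {set 'I_n} -> R) A i j : e (Qrel v A i j) = Qrel (e \o v) A i j.
Proof.
by rewrite /Qrel !(rmorphD, rmorphN, rmorphM, rmorphXn).
Qed.

Lemma Qrel0 n (R : nzRingType) (A : {set 'I_n}) i j :
  Qrel (fun=> 0 : R) A i j = 0.
Proof. by rewrite /Qrel expr0n !(mul0r, subr0, addr0). Qed.

Section MonoidAlgebra.

Import monalg.

Lemma malg_scaleAr (K : monomType) (F : fieldType) (a : F) (x y : {malg F[K]}) : a *: (x * y) = x * (a *: y).
Proof.
apply/malgP => k.
apply: (etrans (mcoeffZ a (x * y) k)).
rewrite (mcoeffMl x y k).
rewrite (mcoeffMlw k (finmap.fsubset_refl _) (msuppZ_le a y)) mulr_sumr.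
apply: eq_bigr => k1 _; rewrite mulr_sumr; apply: eq_bigr => k2 _.
by rewrite mcoeffZ mulrnAr mulrCA.
Qed.

End MonoidAlgebra.

Section Algebra.

Import monalg.

Variables (F : fieldType) (n : nat).

(* The index set of the generators; v_set0 is 0, not a generator. *)
Definition gen := {A : {set 'I_n} | A != set0}.

Local Notation freealg := {malg F[{fmonom gen}]}.

Definition freevar (A : {set 'I_n}) : freealg :=
  if insub A is Some a then << fmu (a : gen) >> else 0.

Inductive Qideal : freealg -> Prop :=
| Qideal_rel (A : {set 'I_n}) (i j : 'I_n) : i \in A -> j \in A -> i != j -> Qideal (Qrel freevar A i j)
| Qideal0 : Qideal 0
| QidealD x y : Qideal x -> Qideal y -> Qideal (x + y)
| QidealMl a x : Qideal x -> Qideal (a * x)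
| QidealMr a x : Qideal x -> Qideal (x * a).

Definition Qideal_pred : {pred freealg} :=
  fun x => if excluded_middle_informative (Qideal x) then true else false.

Lemma QidealP x : reflect (Qideal x) (x \in Qideal_pred).
Proof.
rewrite unfold_in /Qideal_pred.
by case: excluded_middle_informative => h; constructor.
Qed.

Lemma Qideal_zmod_closed : zmod_closed Qideal_pred.
Proof.
split=> [|x y /QidealP Ix /QidealP Iy]; apply/QidealP; first exact: Qideal0.
by apply: QidealD => //; rewrite -mulN1r; apply: QidealMl.
Qed.
HB.instance Definition _ :=
  GRing.isZmodClosed.Build freealg Qideal_pred Qideal_zmod_closed.

Definition Qn := Quotient.quot (Qideal_pred : zmodClosed freealg).
HB.instance Definition _ := GRing.Zmodule.on Qn.
HB.instance Definition _ := EqQuotient.on Qn.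

Definition Qpi (x : freealg) : Qn := (\pi_Qn x)%qT.

Lemma QpiP x y : reflect (Qpi x = Qpi y) (x - y \in Qideal_pred).
Proof. by rewrite Quotient.idealrBE; apply: eqP. Qed.

Lemma Qpi_repr x : Qpi (repr x) = x.
Proof. exact: reprK. Qed.

Lemma Qpi_zmod : zmod_morphism Qpi.
Proof. by move=> x y; rewrite /Qpi Quotient.pi_add Quotient.pi_opp. Qed.
HB.instance Definition _ := GRing.isZmodMorphism.Build freealg Qn Qpi Qpi_zmod.

Definition Qone : Qn := Qpi 1.
Definition Qmul (x y : Qn) : Qn := Qpi (repr x * repr y).
Definition Qscale (c : F) (x : Qn) : Qn := Qpi (c *: repr x).

Lemma QpiM x y : Qpi (x * y) = Qmul (Qpi x) (Qpi y).
Proof.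
apply/QpiP; set x' := repr _; set y' := repr _.
have /QpiP Ix : Qpi x = Qpi x' by rewrite Qpi_repr.
have /QpiP Iy : Qpi y = Qpi y' by rewrite Qpi_repr.
have -> : x * y - x' * y' = (x - x') * y + x' * (y - y').
  by rewrite mulrBl mulrBr addrA subrK.
apply: rpredD; apply/QidealP.
  by apply: QidealMr; apply/QidealP.
by apply: QidealMl; apply/QidealP.
Qed.

Lemma QpiZ c x : Qpi (c *: x) = Qscale c (Qpi x).
Proof.
apply/QpiP; set x' := repr _.
have /QpiP Ix : Qpi x = Qpi x' by rewrite Qpi_repr.
rewrite -scalerBr -[_ - _]mul1r scalerAl.
by apply/QidealP/QidealMl/QidealP.
Qed.

Lemma QmulA : associative Qmul.
Proof.
by move=> x y z; rewrite -[x]Qpi_repr -[y]Qpi_repr -[z]Qpi_repr -!QpiM mulrA.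
Qed.

Lemma Q1mul : left_id Qone Qmul.
Proof. by move=> x; rewrite -[x]Qpi_repr -!QpiM mul1r. Qed.

Lemma Qmul1 : right_id Qone Qmul.
Proof. by move=> x; rewrite -[x]Qpi_repr -!QpiM mulr1. Qed.

Lemma QmulDl : left_distributive Qmul +%R.
Proof.
move=> x y z; rewrite -[x]Qpi_repr -[y]Qpi_repr -[z]Qpi_repr.
by rewrite -(raddfD Qpi) -!QpiM -(raddfD Qpi) mulrDl.
Qed.

Lemma QmulDr : right_distributive Qmul +%R.
Proof.
move=> x y z; rewrite -[x]Qpi_repr -[y]Qpi_repr -[z]Qpi_repr.
by rewrite -(raddfD Qpi) -!QpiM -(raddfD Qpi) mulrDr.
Qed.

Lemma freevar_mcoeff1 A : mcoeff mone (freevar A) = 0.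
Proof.
rewrite /freevar; case: insubP => [a _ _|_]; last exact: mcoeff0.
by rewrite mcoeffU -fdeg_eq0 fdegU.
Qed.

Lemma Qideal_aug (e : {rmorphism freealg -> F}) x :
  (forall A, e (freevar A) = 0) -> Qideal x -> e x = 0.
Proof.
move=> e0; elim=> [A i j _ _ _|| {}x y _ ex _ ey | a {}x _ ex | a {}x _ ex].
- by rewrite Qrel_morph (eq_Qrel _ _ _ e0) Qrel0.
- exact: rmorph0.
- by rewrite rmorphD ex ey addr0.
- by rewrite rmorphM ex mulr0.
- by rewrite rmorphM ex mul0r.
Qed.

Lemma Qone_neq0 : Qone != 0.
Proof.
apply/eqP; rewrite -[0](raddf0 Qpi) => /QpiP/QidealP.
rewrite subr0 => /(@Qideal_aug (mcoeff mone) _ freevar_mcoeff1)/eqP.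
by rewrite rmorph1 oner_eq0.
Qed.

HB.instance Definition _ := GRing.Zmodule_isNzRing.Build Qn
  QmulA Q1mul Qmul1 QmulDl QmulDr Qone_neq0.

Lemma QscaleA a b x : Qscale a (Qscale b x) = Qscale (a * b) x.
Proof. by rewrite -[x]Qpi_repr -!QpiZ scalerA. Qed.

Lemma Qscale1 : left_id 1 Qscale.
Proof. by move=> x; rewrite -[x]Qpi_repr -!QpiZ scale1r. Qed.

Lemma QscaleDr : right_distributive Qscale +%R.
Proof.
move=> a x y; rewrite -[x]Qpi_repr -[y]Qpi_repr.
by rewrite -(raddfD Qpi) -!QpiZ -(raddfD Qpi) scalerDr.
Qed.

Lemma QscaleDl x : {morph Qscale^~ x : a b / a + b}.
Proof. by move=> a b; rewrite -[x]Qpi_repr -!QpiZ -(raddfD Qpi) scalerDl. Qed.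

HB.instance Definition _ := GRing.Zmodule_isLmodule.Build F Qn
  QscaleA Qscale1 QscaleDr QscaleDl.

Lemma QscaleAl (a : F) (x y : Qn) : a *: (x * y) = (a *: x) * y.
Proof.
rewrite -[x]Qpi_repr -[y]Qpi_repr /GRing.scale /GRing.mul /=.
by rewrite -QpiM -!QpiZ -QpiM scalerAl.
Qed.

HB.instance Definition _ := GRing.Lmodule_isLalgebra.Build F Qn QscaleAl.

Lemma QscaleAr (a : F) (x y : Qn) : a *: (x * y) = x * (a *: y).
Proof.
rewrite -[x]Qpi_repr -[y]Qpi_repr /GRing.scale /GRing.mul /=.
by rewrite -QpiM -!QpiZ -QpiM malg_scaleAr.
Qed.

HB.instance Definition _ := GRing.Lalgebra_isAlgebra.Build F Qn QscaleAr.

Lemma Qpi_linear : scalable Qpi.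
Proof. exact: QpiZ. Qed.
HB.instance Definition _ := GRing.isScalable.Build F freealg Qn *:%R Qpi Qpi_linear.

Lemma Qpi_monoid : monoid_morphism Qpi.
Proof. by split; [reflexivity | exact: QpiM]. Qed.
HB.instance Definition _ := GRing.isMonoidMorphism.Build freealg Qn Qpi Qpi_monoid.

Definition Qvar (A : {set 'I_n}) : Qn := Qpi (freevar A).

Lemma Qvar0 : Qvar set0 = 0.
Proof. by rewrite /Qvar /freevar insubF ?eqxx //; apply: raddf0. Qed.

Lemma Qvar_rel (A : {set 'I_n}) i j :
  i \in A -> j \in A -> i != j -> Qrel Qvar A i j = 0.
Proof.
move=> iA jA ij; rewrite -[LHS](Qrel_morph Qpi freevar).
rewrite -(raddf0 Qpi); apply/QpiP; rewrite subr0.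
by apply/QidealP; apply: Qideal_rel.
Qed.

End Algebra.

Section Action.

Import monalg.

Variables (F : fieldType) (n : nat).

Local Notation freealg := {malg F[{fmonom gen n}]}.
Local Notation Qn := (Qn F n).
Local Notation Qpi := (@Qpi F n).

Lemma genact_subproof (s : 'S_n) (a : gen n) : s @: val a != set0.
Proof. by case: a => A nA; rewrite imset_eq0. Qed.

Definition genact (s : 'S_n) (a : gen n) : gen n :=
  exist _ (s @: val a) (genact_subproof s a).

Definition wordact (s : 'S_n) (w : {fmonom gen n}) : freealg :=
  << FMonom (map (genact s) w) >>.

Lemma wordact_mmorphism s : mmorphism (wordact s).
Proof.
split=> [x y|]; last by rewrite /wordact fm1 -fmoneE.
rewrite /wordact malgM_def fgmulUU mulr1; congr (mkmalgU _ _).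
by apply/val_inj; rewrite /= !fmM map_cat.
Qed.
HB.instance Definition _ s := isMultiplicative.Build _ _ _ (wordact_mmorphism s).

Definition freeact (s : 'S_n) : freealg -> freealg := mmap malgC (wordact s).

HB.instance Definition _ s := GRing.Additive.on (freeact s).

Lemma freeact_monoid s : monoid_morphism (freeact s).
Proof.
have h : forall (g : freealg) m m', GRing.comm (malgC (mcoeff m g)) (wordact s m').
  move=> g m m'; rewrite /GRing.comm mul_malgC.
  by rewrite -[X in _ * X]mulr1 mul_malgC -malg_scaleAr mulr1.
have [hM h1] := commr_mmap_is_multiplicative h.
by split.
Qed.
HB.instance Definition _ s :=
  GRing.isMonoidMorphism.Build freealg freealg (freeact s) (freeact_monoid s).

Lemma freeactZ s : scalable (freeact s).
Proof. by move=> c x; rewrite /freeact mmapZ mul_malgC. Qed.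

Lemma freeact_var s A : freeact s (freevar F A) = freevar F (s @: A).
Proof.
rewrite /freevar; case: insubP => [a _ <-|].
  rewrite /freeact mmapU mul1r /wordact fmU /= insubT ?genact_subproof //= => h.
  by rewrite fmuE; congr << FMonom [:: _] >>; apply: val_inj.
rewrite negbK => /eqP->; rewrite imset0 insubF ?eqxx //; exact: mmap0.
Qed.

Lemma freeact_ideal s x : Qideal x -> Qideal (freeact s x).
Proof.
elim=> [A i j iA jA ij || {}x y _ ix _ iy | a {}x _ ix | a {}x _ ix].
- have -> : freeact s (Qrel (freevar F (n:=n)) A i j)
          = Qrel (freevar F (n:=n)) (s @: A) (s i) (s j).
    have sD B k : s @: (B :\ k) = s @: B :\ s k.
      apply/setP=> y; rewrite -(permKV s y) !inE (inj_eq perm_inj).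
      by rewrite !(mem_imset _ _ (@perm_inj _ s)) !inE.
    rewrite Qrel_morph /Qrel /=.
    by rewrite !(freeact_var, sD).
  by apply: Qideal_rel; rewrite ?imset_f // (inj_eq perm_inj).
- by rewrite rmorph0; apply: Qideal0.
- have -> := raddfD (freeact s) x y.
  exact (QidealD ix iy).
- have -> := rmorphM (freeact s) a x.
  exact (QidealMl _ ix).
- have -> := rmorphM (freeact s) x a.
  exact (QidealMr _ ix).
Qed.

Definition Qact (s : 'S_n) (x : Qn) : Qn := Qpi (freeact s (repr x)).

Lemma Qact_pi s x : Qact s (Qpi x) = Qpi (freeact s x).
Proof.
apply/QpiP; rewrite -(rmorphB (freeact s)); apply/QidealP/freeact_ideal/QidealP.
by apply/QpiP; rewrite Qpi_repr.
Qed.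

Lemma Qact_scalable s : scalable (Qact s).
Proof.
by move=> c x; rewrite -[x]Qpi_repr -Qpi_linear !Qact_pi freeactZ Qpi_linear.
Qed.
Lemma Qact_linear s : linear (Qact s).
Proof.
have Qpi_lin c u v : Qpi (c *: u + v) = c *: Qpi u + Qpi v.
  by rewrite -(Qpi_linear c u); exact: (raddfD Qpi).
have free_lin c u v : freeact s (c *: u + v) = c *: freeact s u + freeact s v.
  by rewrite -(freeactZ s c u); exact: (raddfD (freeact s)).
move=> c x y; have e : Qpi (c *: repr x + repr y) = c *: x + y.
  apply: (etrans (Qpi_lin c (repr x) (repr y))).
  exact (congr2 (fun u v => c *: u + v) (Qpi_repr x) (Qpi_repr y)).
apply: (etrans (congr1 (Qact s) (esym e))).
apply: (etrans (Qact_pi s _)).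
apply: (etrans (congr1 Qpi (free_lin c (repr x) (repr y)))).
exact: Qpi_lin.
Qed.
HB.instance Definition _ s :=
  GRing.isLinear.Build F Qn Qn *:%R (Qact s) (Qact_linear s).

Lemma Qact_monoid s : monoid_morphism (Qact s).
Proof.
split=> [|x y]; first by rewrite -(rmorph1 Qpi) Qact_pi (rmorph1 (freeact s)).
rewrite -[x]Qpi_repr -[y]Qpi_repr -(rmorphM Qpi) !Qact_pi.
by rewrite -(rmorphM Qpi) (rmorphM (freeact s)).
Qed.
HB.instance Definition _ s :=
  GRing.isMonoidMorphism.Build Qn Qn (Qact s) (Qact_monoid s).

Lemma Qact_var s A : Qact s (Qvar F A) = Qvar F (s @: A).
Proof. by rewrite Qact_pi freeact_var. Qed.

End Action.

Lemma free_uniq (F : fieldType) (V : lmodType F) d (b : 'I_d -> V) :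
    (forall u : 'I_d -> F, \sum_i u i *: b i = 0 -> forall i, u i = 0) ->
  forall u v : 'I_d -> F, \sum_i u i *: b i = \sum_i v i *: b i -> u =1 v.
Proof.
move=> bfree u v e i; apply/eqP; rewrite -subr_eq0; apply/eqP.
apply: (bfree (fun i => u i - v i)); under eq_bigr do rewrite scalerBl.
by rewrite sumrB e subrr.
Qed.

Lemma span_basis (F : fieldType) (V : lmodType F) (l : seq V) : exists d (b : 'I_d -> V),
  [/\ forall i, b i \in l,
      forall u : 'I_d -> F, \sum_i u i *: b i = 0 -> forall i, u i = 0
    & forall x, x \in l -> exists u : 'I_d -> F, x = \sum_i u i *: b i].
Proof.
elim: l => [|x l [d [b [bl bfree bspan]]]].
  by exists 0%N, (fun=> 0); split=> // [[]|u _ []].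
have [[u xE] | xN] :=
    classic (exists u : 'I_d -> F, x = \sum_i u i *: b i).
  exists d, b; split=> // [i|y]; first by rewrite inE bl orbT.
  by rewrite inE => /predU1P[->|/bspan//]; exists u.
exists d.+1, (fun i => if unlift ord0 i is Some j then b j else x).
split=> [i|u|y].
- by case: unliftP => [j _|_]; rewrite inE ?eqxx ?bl ?orbT.
- rewrite big_ord_recl unlift_none; under eq_bigr do rewrite liftK.
  have [u0|u0] := eqVneq (u ord0) 0.
    rewrite u0 scale0r add0r => /bfree hu i.
    by case: (unliftP ord0 i) => [j ->|->]; first exact: hu.
  move=> e; case: xN; exists (fun i => - (u ord0)^-1 * u (lift ord0 i)).
  under eq_bigr do rewrite -scalerA; rewrite -scaler_sumr.
  move/eqP: e; rewrite addrC addr_eq0 => /eqP->.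
  by rewrite scaleNr scalerN opprK scalerA mulVf ?scale1r.
- have ext (v : 'I_d -> F) c : exists u : 'I_d.+1 -> F,
      c *: x + \sum_i v i *: b i
      = \sum_i u i *: (if unlift ord0 i is Some j then b j else x).
    exists (fun i => if unlift ord0 i is Some j then v j else c).
    by rewrite big_ord_recl unlift_none; under [in RHS]eq_bigr do rewrite liftK.
  rewrite inE => /predU1P[->|/bspan[v ->]].
    have [u hu] := ext (fun=> 0) 1; exists u; rewrite -hu scale1r.
    by rewrite big1 ?addr0 // => i _; rewrite scale0r.
  by have [u hu] := ext v 0; exists u; rewrite -hu scale0r add0r.
Qed.

Lemma matrix_rep_exists (F : fieldType) (V : lmodType F) (gT : finGroupType)
    (G : {group gT}) (P : V -> Prop) (act : gT -> V -> V) (T : finType)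
    (word : T -> V) :
    (forall t, P (word t)) ->
    (forall x, P x -> exists c : T -> F, x = \sum_t c t *: word t) ->
    (forall g d (c : 'I_d -> F) (x : 'I_d -> V),
      act g (\sum_i c i *: x i) = \sum_i c i *: act g (x i)) ->
    (forall g x, P x -> P (act g x)) ->
    (forall x, P x -> act 1%g x = x) ->
    (forall g h x, P x -> act (g * h)%g x = act h (act g x)) ->
  exists d (b : 'I_d -> V) (rho : mx_representation F G d),
  [/\ forall i, P (b i),
      forall u : 'I_d -> F, \sum_i u i *: b i = 0 -> forall i, u i = 0,
      forall x, P x -> exists u : 'I_d -> F, x = \sum_i u i *: b i
    & forall g p, act g (b p) = \sum_q rho g p q *: b q].
Proof.
move=> Pword Pgen act_sum Pact act1 actM.
have [d [b [bl bfree bspan]]] := span_basis (map word (enum T)).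
have bC i : P (b i) by have /mapP[w _ ->] := bl i.
have wspan w : exists u : 'I_d -> F, word w = \sum_i u i *: b i.
  by apply: bspan; rewrite map_f ?mem_enum.
have Cspan x : P x -> exists u : 'I_d -> F, x = \sum_i u i *: b i.
  move/Pgen=> [c ->].
  pose uw w := projT1 (constructive_indefinite_description _ (wspan w)).
  exists (fun i => \sum_w c w * uw w i).
  transitivity (\sum_w c w *: \sum_i uw w i *: b i).
    apply: eq_bigr => w _; congr (_ *: _).
    by rewrite /uw; case: constructive_indefinite_description.
  under [LHS]eq_bigr do rewrite scaler_sumr.
  rewrite exchange_big; apply: eq_bigr => i _; rewrite scaler_suml.
  by apply: eq_bigr => w _; rewrite scalerA.
have hm g p : exists u : 'I_d -> F, act g (b p) = \sum_q u q *: b q.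
  exact/Cspan/Pact.
pose rho g : 'M[F]_d := \matrix_(p, q)
  projT1 (constructive_indefinite_description _ (hm g p)) q.
have rhoE g p : act g (b p) = \sum_q rho g p q *: b q.
  under eq_bigr do rewrite mxE.
  by case: constructive_indefinite_description.
have buniq := free_uniq bfree.
have rho_repr : mx_repr G rho.
  split=> [|g h _ _]; apply/matrixP=> p; apply: buniq; rewrite -rhoE.
    rewrite act1 // (bigD1 p) //= mxE eqxx scale1r big1 ?addr0 // => q qp.
    by rewrite mxE eq_sym (negPf qp) scale0r.
  rewrite actM // rhoE act_sum.
  under eq_bigr do rewrite rhoE scaler_sumr.
  rewrite exchange_big; apply: eq_bigr => q _; rewrite mxE scaler_suml.
  by apply: eq_bigr => k _; rewrite scalerA.
by exists d, b, (MxRepresentation rho_repr).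
Qed.

Section Component.

Variables (F : fieldType) (n : nat).

Local Notation Qn := (Qn F n).
Local Notation Sn := [set: 'S_n].

Definition Qcomp (r : nat) (x : Qn) : Prop :=
  exists c : r.-tuple (gen n) -> F,
    x = \sum_w c w *: \prod_(a <- w) Qvar F (val a).

Definition is_basis d (b : 'I_d -> Qn) (P : Qn -> Prop) : Prop :=
  [/\ forall i, P (b i),
      forall u : 'I_d -> F, \sum_i u i *: b i = 0 -> forall i, u i = 0
    & forall x, P x -> exists u : 'I_d -> F, x = \sum_i u i *: b i].

(* Row convention: [rho s] acts on row vectors on the right, which matches  *)
(* the composition order of MathComp, [(s * t) i = t (s i)].                 *)
Definition affords_Qcomp r d (rho : mx_representation F Sn d) : Prop :=
  exists2 b, is_basis b (Qcomp r)
    & forall s p, Qact s (b p) = \sum_q rho s p q *: b q.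

Lemma QcompD r x y : Qcomp r x -> Qcomp r y -> Qcomp r (x + y).
Proof.
move=> [c ->] [e ->]; exists (fun w => c w + e w).
by rewrite -big_split /=; apply: eq_bigr => w _; rewrite scalerDl.
Qed.

Lemma QcompZ r a x : Qcomp r x -> Qcomp r (a *: x).
Proof.
move=> [c ->]; exists (fun w => a * c w).
by rewrite scaler_sumr; apply: eq_bigr => w _; rewrite scalerA.
Qed.

Lemma Qcomp0 r : Qcomp r 0.
Proof. by exists (fun=> 0); rewrite big1 // => w _; rewrite scale0r. Qed.

Lemma Qcomp_word r (w : r.-tuple (gen n)) :
  Qcomp r (\prod_(a <- w) Qvar F (val a)).
Proof.
exists (fun w' => (w' == w)%:R); rewrite (bigD1 w) //= eqxx scale1r.
rewrite [X in _ + X]big1 ?addr0 // => w1 /negPf->; exact: scale0r.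
Qed.

Lemma Qcomp_sum r (I : finType) (c : I -> F) (x : I -> Qn) :
  (forall i, Qcomp r (x i)) -> Qcomp r (\sum_i c i *: x i).
Proof.
move=> hx; apply: (big_ind (Qcomp r)) => [|y z|i _]; first exact: Qcomp0.
  exact: QcompD.
exact: QcompZ.
Qed.

Lemma Qact_word s r (w : r.-tuple (gen n)) :
  Qact s (\prod_(a <- w) Qvar F (val a))
  = \prod_(a <- [tuple of map (genact s) w]) Qvar F (val a).
Proof.
rewrite (rmorph_prod (Qact s)) /= big_map.
by apply: eq_bigr => a _; rewrite Qact_var.
Qed.

Lemma Qact_sum s (I : finType) (c : I -> F) (x : I -> Qn) :
  Qact s (\sum_i c i *: x i) = \sum_i c i *: Qact s (x i).
Proof.
rewrite (raddf_sum (Qact s)).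
have E i : Qact s (c i *: x i) = c i *: Qact s (x i) by exact: Qact_scalable.
by apply: eq_bigr => i _; apply: E.
Qed.

Lemma Qcomp_act r s x : Qcomp r x -> Qcomp r (Qact s x).
Proof.
move=> [c ->]; rewrite Qact_sum.
by apply: Qcomp_sum => w; rewrite Qact_word; apply: Qcomp_word.
Qed.

Lemma Qact1 r x : Qcomp r x -> Qact 1%g x = x.
Proof.
move=> [c ->]; rewrite Qact_sum; apply: eq_bigr => w _.
rewrite Qact_word big_map; congr (_ *: _).
apply: eq_bigr => a _; congr Qvar.
by rewrite /= (eq_imset _ (@perm1 _)) imset_id.
Qed.

Lemma QactM r s t x : Qcomp r x -> Qact (s * t)%g x = Qact t (Qact s x).
Proof.
move=> [c ->]; rewrite !Qact_sum; apply: eq_bigr => w _.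
rewrite !Qact_word !big_map; congr (_ *: _).
apply: eq_bigr => a _; congr Qvar => /=.
by rewrite -imset_comp; apply: eq_imset => i; rewrite /= permM.
Qed.

Lemma Qrep_exists r :
  exists rho : {d & mx_representation F Sn d}, affords_Qcomp r (projT2 rho).
Proof.
pose word (w : r.-tuple (gen n)) : Qn := \prod_(a <- w) Qvar F (val a).
have [||||||d [b [rho [bC bfree bspan rhoE]]]] :=
  @matrix_rep_exists F _ _ Sn (Qcomp r) (@Qact F n) _ word.
- exact: Qcomp_word.
- by move=> x [c ->]; exists c.
- by move=> s d c x; apply: Qact_sum.
- by move=> s x; apply: Qcomp_act.
- exact: Qact1.
- by move=> s t x; apply: QactM.
by exists (existT _ d rho); exists b.
Qed.

(* A matrix form of the action of 'S_n on the degree r component; see QrepP.  *)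
Definition Qrep_sig r :=
  projT1 (constructive_indefinite_description _ (Qrep_exists r)).

Definition Qdim r : nat := projT1 (Qrep_sig r).

Definition Qrep r : mx_representation F Sn (Qdim r) := projT2 (Qrep_sig r).

Lemma QrepP r : affords_Qcomp r (Qrep r).
Proof.
exact: (projT2 (constructive_indefinite_description _ (Qrep_exists r))).
Qed.

End Component.

Section Multiplicity.

Variables (F : fieldType) (gT : finGroupType) (G : {group gT}).

Definition is_multiplicity dV (rV : mx_representation F G dV)
    dW (rW : mx_representation F G dW) (m : nat) : Prop :=
  exists (s : nat) (U : 'I_s -> 'M[F]_dW) (modU : forall i, mxmodule rW (U i))
         (J : {set 'I_s}),
  [/\ forall i, mxsimple rW (U i),
      mxdirect (\sum_i U i),
      (\sum_i U i :=: 1%:M)%MS,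
      forall i, i \in J <-> mx_rsim (submod_repr (modU i)) rV
    & #|J| = m].

(* Such an m exists (Maschke) and is unique (Jordan-Hoelder) when the        *)
(* characteristic of F does not divide the order of G.                       *)
Definition multiplicity dV (rV : mx_representation F G dV)
    dW (rW : mx_representation F G dW) : nat :=
  epsilon (inhabits 0%N) (is_multiplicity rV rW).

End Multiplicity.

Section Specht.

Variables (F : fieldType) (n : nat) (lam : seq nat).

Local Notation Sn := [set: 'S_n].

(* The points of 'I_n fill the Young diagram of [lam] row by row:            *)
(* [reshape_index lam i] is the row of i, [reshape_offset lam i] its column. *)
Definition row_stab : {set 'S_n} :=
  [set s : 'S_n | [forall i, reshape_index lam (s i) == reshape_index lam i]].

Definition col_stab : {set 'S_n} :=
  [set s : 'S_n | [forall i, reshape_offset lam (s i) == reshape_offset lam i]].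

(* (sum over row_stab of p) o (sum over col_stab of (-1)^q q); the function  *)
(* composite p o q is (q * p)%g in MathComp, so that left multiplication for *)
(* composition is the right multiplication of [regular_repr].                *)
Definition young_symmetrizer : 'rV[F]_#|Sn| :=
  \sum_(p in row_stab) \sum_(q in col_stab)
    (-1) ^+ q *: delta_mx 0 (gring_index [set: 'S_n] (q * p)%g).

Definition specht :=
  submod_repr (cyclic_mx_module (regular_repr F [set: 'S_n]) young_symmetrizer).

End Specht.

(* A partition of n, padded with zeros to n parts.                            *)
Definition intpart (n : nat) :=
  {j : n.-tuple 'I_n.+1
  | sorted geq (map val j) && (sumn (map val j) == n)}.

Definition npart n (j : intpart n) (q : nat) : nat :=
  count_mem q (map val (val j)).

Definition conj_class n (j : intpart n) : {set 'S_n} :=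
  [set s : 'S_n | [forall q : 'I_n.+1,
    (0 < q)%N ==> (#|[set X in porbits s | #|X| == q]| == npart j q)]].

Section Frobenius.

Variables (F : fieldType) (n k : nat).

Definition vandermonde_prod : {mpoly F[k]} :=
  \prod_(p < k) \prod_(q < k | (p < q)%N) ('X_p - 'X_q).

Definition power_sum (q : nat) : {mpoly F[k]} := \sum_(i < k) 'X_i ^+ q.

Definition frobenius_poly (j : intpart n) : {mpoly F[k]} :=
  vandermonde_prod * \prod_(1 <= q < n.+1) power_sum q ^+ npart j q.

Definition frobenius_exp (lam : k.-tuple nat) : 'X_{1..k} :=
  [multinom (tnth lam i + (k - i.+1))%N | i < k].

(* Formal power series in t are represented by their coefficient sequences.   *)
Definition trace_series (s : 'S_n) : nat -> F := fun i => \tr (Qrep F n i s).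

Definition frobenius_bracket (C : intpart n -> 'S_n) : nat -> {mpoly F[k]} :=
  fun i => ((n`!)%:R : F)^-1 *:
    \sum_(j : intpart n)
      (#|conj_class j|%:R * trace_series (C j) i) *: frobenius_poly j.

End Frobenius.

(* Main.v *)
(** Nothing about Q_n is used beyond its being a representation W of S_n.  Let
    c be the Young symmetrizer of lambda, so that c^2 = h c with h != 0 and
    c F[S_n] c = F c.

    The multiplicity is tr(W(c)) / h: a simple module on which c does not act by
    zero is isomorphic to c F[S_n], where c has rank one and trace h.

    Let X_lambda(chi) be the coefficient of x^(lambda+rho) in
    Delta * (1/n!) sum_s chi(s) P_s, where P_s is the product of the power sums
    over the cycles of s, i.e. the sum of x^f over the colorings f fixed by s.
    To see that X_lambda(chi) = chi(c) / h for every class function chi, test it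
    on sigma_nu(g) = tr(u |-> c_nu u g) / h_nu, nu a partition of n.  These are
    dual to the functionals chi |-> chi(c_nu) / h_nu, so by counting conjugacy
    classes they are a basis, and it remains to prove that
    X_lambda(sigma_nu) = [lambda = nu].
    - The monomials of Delta have prefix sums at most those of rho, and those of
      the Frobenius characteristic of sigma_nu at most those of nu.  Hence
      X_lambda(sigma_nu) = 0 unless nu dominates lambda, and
      X_lambda(sigma_lambda) = 1.
    - The permutation character psi_mu of the Young subgroup S_mu has
      characteristic the product of the complete symmetric functions h_(mu_i),
      so by the Pieri rule X_lambda(psi_mu) = 0 unless lambda dominates mu.  As
      psi_mu is a combination of sigma_nu for nu dominating mu, sigma_mu
      occurring, downward induction on mu shows that X_lambda(sigma_mu) = 0
      unless lambda dominates mu. *)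

From Stdlib Require Import ClassicalEpsilon.
Require Import Defs.
From mathcomp Require Import all_boot all_order all_algebra all_fingroup.
From mathcomp Require Import all_solvable all_character mpoly zify.

Set Implicit Arguments.
Unset Strict Implicit.
Unset Printing Implicit Defensive.

Import GRing.Theory.

(** * Young diagrams *)

(** Equal fibre sizes say that the tuples of values are permutations of each other, and such a
    permutation acts on the positions. *)
Lemma eq_fibers_perm n (Y : eqType) (f g : 'I_n -> Y) :
  (forall y, #|[set i | f i == y]| = #|[set i | g i == y]|) ->
  exists s : 'S_n, f =1 g \o s.
Proof.
move=> fg; have cnt (h : 'I_n -> Y) y :
    count_mem y [tuple h i | i < n] = #|[set i | h i == y]|.
  rewrite /= count_map -sum1_count big_enum_cond /=.
  by rewrite -sum1_card; apply: eq_bigl => i; rewrite inE.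
have /tuple_permP[s E] : perm_eq [tuple f i | i < n] [tuple g i | i < n].
  by apply/allP => y _ /=; apply/eqP; rewrite !cnt fg.
exists s => i; have /(congr1 (fun t => tnth t i)) := val_inj E.
by rewrite !tnth_mktuple.
Qed.

(** Listing each y with multiplicity [h y] gives a list of length n, whose entries serve as the
    values of f. *)
Lemma fibers_exist n (Y : finType) (h : Y -> nat) :
  \sum_y h y = n ->
  exists f : 'I_n -> Y, forall y, #|[set i | f i == y]| = h y.
Proof.
pose L := flatten [seq nseq (h y) y | y <- enum Y] => hn.
have sL : size L == n.
  rewrite size_flatten /shape -map_comp sumnE big_map big_enum_cond -hn.
  by apply/eqP/eq_bigr => y _; rewrite /= size_nseq.
exists (tnth (Tuple sL)) => y; transitivity (count_mem y L); last first.
  rewrite count_flatten -map_comp sumnE big_map big_enum_cond /= (bigD1 y) //=.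
  rewrite count_nseq /= eqxx mul1n big1 ?addn0 // => z zy.
  by rewrite count_nseq /= (negPf zy).
transitivity (count_mem y [seq tnth (Tuple sL) i | i <- enum 'I_n]);
  last by rewrite map_tnth_enum.
rewrite count_map -sum1_count.
by rewrite big_enum_cond /= -sum1_card; apply: eq_bigl => i; rewrite inE.
Qed.

Lemma card_sum_fibers (T : finType) (A : {set T}) (g : T -> nat) M :
  (forall x, g x < M) -> #|A| = \sum_(c < M) #|[set x in A | g x == c]|.
Proof.
move=> gM; rewrite -sum1_card (partition_big (fun x => Ordinal (gM x)) xpredT) //=.
by apply: eq_bigr => c _; rewrite -sum1_card; apply: eq_bigl => x; rewrite inE.
Qed.

Section Diagram.

Variables (n : nat) (row col : 'I_n -> nat).

Hypothesis rc_inj : forall x y, row x = row y -> col x = col y -> x = y.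
Hypothesis rc_closed :
  forall x i, i <= row x -> exists2 y, row y = i & col y = col x.

Section Count.

Variable f : 'I_n -> nat.
Hypothesis f_inj : forall x y, f x = f y -> col x = col y -> x = y.

(* Column c has rows 0, ..., |column c| - 1, and f is injective on it. *)
Lemma card_column_le c m :
  #|[set x in [set x | f x < m] | col x == c]|
  <= #|[set x in [set x | row x < m] | col x == c]|.
Proof.
(* If the column reaches row m, it has m cells in the rows before m, while f has only m values below
   m. Otherwise the whole column is counted on the right. *)
have [/existsP[x /andP[xc mx]] | /existsPn small] :=
    boolP [exists x, (col x == c) && (m <= row x)].
  have le_m : #|[set x in [set x | f x < m] | col x == c]| <= m.
    have [->|[z]] := set_0Vmem [set x in [set x | f x < m] | col x == c].
      by rewrite cards0.
    rewrite !inE => /andP[zm _]; case: m zm {mx} => // m _.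
    rewrite -[X in _ <= X]card_ord.
    rewrite -(@card_in_imset _ _ (fun x => inord (f x) : 'I_m.+1)) ?max_card //.
    move=> y1 y2; rewrite !inE => /andP[y1m /eqP y1c] /andP[y2m /eqP y2c].
    by move/(congr1 val); rewrite /= !inordK // => /f_inj; apply; rewrite y1c.
  apply: leq_trans le_m _.
  have yP (i : 'I_m) : {y | (row y == i) && (col y == c)}.
    apply/sigW; have [|y yi yc] := @rc_closed x i;
      first exact: leq_trans (ltnW _) mx.
    by exists y; rewrite yi yc eqxx.
  rewrite -[X in X <= _]card_ord -(@card_imset _ _ (fun i => sval (yP i))).
    apply/subset_leq_card/subsetP => _ /imsetP[i _ ->].
    by case: (yP i) => y /= /andP[/eqP yi /eqP yc]; rewrite !inE yi yc eqxx ltn_ord.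
  move=> i j; case: (yP i) => y /= /andP[/eqP yi _].
  by case: (yP j) => z /= /andP[/eqP zj _] yz; apply: val_inj;
    rewrite /= -yi -zj yz.
apply/subset_leq_card/subsetP => x; rewrite !inE => /andP[_ xc]; rewrite xc andbT.
by have := small x; rewrite xc /= -ltnNge.
Qed.

Let M := (\max_x col x).+1.
Let colM x : col x < M. Proof. by rewrite ltnS leq_bigmax. Qed.

(** Sum the bound over the columns. Every dominance relation obtained from a Young symmetrizer rests
    on this inequality. *)
Lemma card_dominance m : #|[set x | f x < m]| <= #|[set x | row x < m]|.
Proof.
rewrite !(card_sum_fibers _ colM); apply: leq_sum => c _.
exact: card_column_le.
Qed.

(** Equal totals force equality in the bound for each column and each m. So f and [row] have the
    same values with the same multiplicities in every column, and a permutation inside the columns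
    matches them. *)
Lemma column_perm :
  (forall m, #|[set x | f x < m]| = #|[set x | row x < m]|) ->
  exists2 q : 'S_n, forall x, col (q x) = col x & forall x, f (q x) = row x.
Proof.
move=> fr.
have E c m : #|[set x in [set x | f x < m] | col x == c]|
    = #|[set x in [set x | row x < m] | col x == c]|.
  have [cM | Mc] := ltnP c M; last first.
    have N g : [set x in [set x | g x < m] | col x == c] = set0.
      apply/setP => x; rewrite !inE andbC; case: eqP => // xc.
      by have := colM x; rewrite xc ltnNge Mc.
    by rewrite !N.
  have := leqif_sum (fun (c : 'I_M) (_ : true) => leqif_eq (card_column_le c m)).
  rewrite -!(card_sum_fibers _ colM) fr => -[_]; rewrite eqxx => /esym/forallP.
  by move=> /(_ (Ordinal cM))/eqP.
have [|q qE] := @eq_fibers_perm n _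
  (fun x => (row x, col x)) (fun x => (f x, col x)).
  move=> [m c]; have D g : #|[set x | (g x, col x) == (m, c)]|
    = #|[set x in [set x | g x < m.+1] | col x == c]|
      - #|[set x in [set x | g x < m] | col x == c]|.
    rewrite -cardsDS; last first.
      by apply/subsetP => x; rewrite !inE => /andP[/ltnW xm ->]; rewrite ltnS xm.
    apply: eq_card => x; rewrite !inE xpair_eqE ltnS.
    by case: (col x == c); rewrite ?andbF // !andbT -leqNgt andbC eqn_leq.
  by rewrite !D !E.
by exists q => x; have [] := qE x.
Qed.

End Count.

End Diagram.

Lemma reshape_index_lt s i m : i < sumn s ->
  (reshape_index s i < m) = (i < sumn (take m s)).
Proof.
rewrite /reshape_index; elim: s i m => [|a s IH] i [|m] //=.
rewrite subn_eq0 => ias; have [ia|ai] := ltnP i a; first by rewrite ltn_addr.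
by rewrite ltnS subSn // IH ?ltn_subLR.
Qed.

(** Prefix sums ignore trailing zeros, so the k entries of [lam] and the n entries of an [intpart]
    are seen to fill the same diagram. *)
Lemma reshape_index_eq s1 s2 i :
    (forall m, sumn (take m s1) = sumn (take m s2)) -> i < sumn s1 ->
  reshape_index s1 i = reshape_index s2 i.
Proof.
move=> e i1; have i2 : i < sumn s2.
  have := e (maxn (size s1) (size s2)).
  by rewrite !take_oversize ?leq_maxl ?leq_maxr // => <-.
have lt m : (reshape_index s1 i < m) = (reshape_index s2 i < m).
  by rewrite !reshape_index_lt // e.
by apply/eqP; rewrite eqn_leq -ltnS lt ltnSn /= -ltnS -lt ltnSn.
Qed.

Lemma reshape_offset_eq s1 s2 i :
    (forall m, sumn (take m s1) = sumn (take m s2)) -> i < sumn s1 ->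
  reshape_offset s1 i = reshape_offset s2 i.
Proof. by move=> e i1; rewrite /reshape_offset (reshape_index_eq e) // e. Qed.

Lemma sorted_geq_nth s i j : sorted geq s -> i <= j -> nth 0 s j <= nth 0 s i.
Proof.
move=> ss ij; have [js|?] := ltnP j (size s); last by rewrite nth_default.
have tr : transitive geq by move=> a b c ab bc; apply: leq_trans bc ab.
by apply: (sorted_leq_nth tr leqnn 0 ss) => //; rewrite inE (leq_ltn_trans ij).
Qed.

Lemma card_ord_lt n m : m <= n -> #|[set i : 'I_n | i < m]| = m.
Proof.
move=> mn; rewrite -[RHS]card_ord -(card_imset _ (f := widen_ord mn));
  last by move=> i j /(congr1 val) /= /val_inj.
apply: eq_card => i; rewrite inE; apply/idP/imsetP => [im|[j _ ->]];
  last by rewrite /= ltn_ord.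
by exists (Ordinal im) => //; apply: val_inj.
Qed.

Section Shape.

Variables (n : nat) (s : seq nat).
Hypotheses (s_sorted : sorted geq s) (s_sum : sumn s = n).

Definition rowf (x : 'I_n) := reshape_index s x.
Definition colf (x : 'I_n) := reshape_offset s x.

Lemma row_col_inj x y : rowf x = rowf y -> colf x = colf y -> x = y.
Proof.
move=> r c; apply: val_inj.
by rewrite /= -(reshape_indexK s x) -(reshape_indexK s y) -/(rowf x) -/(colf x) r c.
Qed.

Lemma row_col_closed x i :
  i <= rowf x -> exists2 y, rowf y = i & colf y = colf x.
Proof.
move=> ix; have xs : x < sumn s by rewrite s_sum.
have cx := leq_trans (reshape_offsetP xs) (sorted_geq_nth s_sorted ix).
have lt := flatten_indexP cx; rewrite s_sum in lt.
by exists (Ordinal lt); rewrite /rowf /colf /= ?flatten_indexKl ?flatten_indexKr.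
Qed.

Lemma card_row_lt m : #|[set x | rowf x < m]| = sumn (take m s).
Proof.
rewrite -[RHS](@card_ord_lt n); last first.
  by rewrite -s_sum -[in leqRHS](cat_take_drop m s) sumn_cat leq_addr.
by apply: eq_card => x; rewrite !inE reshape_index_lt ?s_sum.
Qed.

Lemma card_row_eq m : #|[set x | rowf x == m]| = nth 0 s m.
Proof.
have -> : [set x | rowf x == m] = [set x | rowf x < m.+1] :\: [set x | rowf x < m].
  by apply/setP => x; rewrite !inE ltnS eqn_leq -leqNgt andbC.
rewrite cardsDS; last by apply/subsetP => x; rewrite !inE ltnS => /ltnW.
rewrite !card_row_lt; have [ms|sm] := ltnP m (size s).
  by rewrite (take_nth 0) // sumn_rcons addKn.
by rewrite nth_default // !take_oversize ?subnn // ltnW.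
Qed.

End Shape.

(** * Cycle types *)

Section CycleConjugacy.

Variable n : nat.
Implicit Types s t u : 'S_n.

Lemma eq_permX_porbit s x i j :
  ((s ^+ i)%g x == (s ^+ j)%g x) = (i == j %[mod #|porbit s x|]).
Proof.
have q0 : 0 < #|porbit s x| by rewrite lt0n card_porbit_neq0.
set q := #|_| in q0 *; have md k : (s ^+ k)%g x = (s ^+ (k %% q))%g x.
  rewrite {1}(divn_eq k q) expgD permM; congr (fun_of_perm _ _).
  elim: (k %/ q) => [|d IH]; first by rewrite perm1.
  by rewrite mulSn expgD permM [(s ^+ q)%g x]permX iter_porbit.
rewrite (md i) (md j).
have lt k : k %% q < q by rewrite ltn_mod.
have nt k : (s ^+ (k %% q))%g x = nth x (traject s x q) (k %% q).
  by rewrite nth_traject // permX.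
by rewrite !nt nth_uniq ?size_traject ?uniq_traject_porbit.
Qed.

Definition cycles_of_size s q := [set X in porbits s | #|X| == q].

(** The cycles of s and t are matched length by length, a base point is chosen in each, and the
    conjugator carries the i-th iterate of a base point under s to the i-th iterate under t of the
    matching one. *)
Lemma conj_of_cycle_sizes s t :
    (forall q, 0 < q -> #|cycles_of_size s q| = #|cycles_of_size t q|) ->
  exists u, t = (s ^ u)%g.
Proof.
move=> st; pose f (X : {set 'I_n}) :=
  nth set0 (enum (cycles_of_size t #|X|)) (index X (enum (cycles_of_size s #|X|))).
have idx x : index (porbit s x) (enum (cycles_of_size s #|porbit s x|))
     < size (enum (cycles_of_size t #|porbit s x|)).
  rewrite -cardE -st ?lt0n ?card_porbit_neq0 // [#|cycles_of_size s _|]cardE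
    index_mem mem_enum inE eqxx andbT.
  exact: imset_f.
have fP x : f (porbit s x) \in cycles_of_size t #|porbit s x|.
  by rewrite -mem_enum; apply: mem_nth.
have f_inj x y : f (porbit s x) = f (porbit s y) -> porbit s x = porbit s y.
  move=> e; have := fP x; rewrite e inE => /andP[_].
  have := fP y; rewrite inE => /andP[_ /eqP ->] /eqP q.
  have ix := idx x; have iy := idx y; move: e; rewrite /f -q => /eqP.
  rewrite -q in ix; rewrite nth_uniq ?enum_uniq // => /eqP e.
  rewrite -(nth_index set0 (x := porbit s x)
    (s := enum (cycles_of_size s #|porbit s y|))).
    rewrite e nth_index // mem_enum inE eqxx imset_f //.
  by rewrite mem_enum inE -q eqxx imset_f.
(* Base points depend on the cycle only, as [rs_eq] and [rt_eq] check. The default x is never taken,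
   since cycles are nonempty. *)
pose rs x := odflt x [pick y in porbit s x].
pose rt x := odflt x [pick y in f (porbit s x)].
have rsP x : rs x \in porbit s x.
  by rewrite /rs; case: pickP => [//|/(_ x)]; rewrite porbit_id.
have rtP x : porbit t (rt x) = f (porbit s x).
  have := fP x; rewrite inE => /andP[/imsetP[y _ fy] _].
  rewrite /rt; case: pickP => [z|/(_ y)]; last by rewrite fy porbit_id.
  by rewrite fy => zy; apply/eqP; rewrite eq_porbit_mem.
have rs_eq x y : porbit s x = porbit s y -> rs x = rs y.
  by move=> e; rewrite /rs e; case: pickP => // /(_ y); rewrite porbit_id.
have rt_eq x y : porbit s x = porbit s y -> rt x = rt y.
  move=> e; have := fP y; rewrite inE => /andP[/imsetP[z _ fy] _].
  by rewrite /rt e; case: pickP => // /(_ z); rewrite fy porbit_id.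
have ex_i x : exists i, x == (s ^+ i)%g (rs x).
  have /porbitP[i e] : x \in porbit s (rs x) by rewrite porbit_sym.
  by exists i; apply/eqP.
pose ix x := ex_minn (ex_i x).
have ixP x : x = (s ^+ ix x)%g (rs x) by rewrite /ix; case: ex_minnP => i /eqP.
pose u0 x := (t ^+ ix x)%g (rt x).
have card_rt x : #|porbit t (rt x)| = #|porbit s (rs x)|.
  have /eqP -> : porbit s (rs x) == porbit s x by rewrite eq_porbit_mem.
  by rewrite rtP; have := fP x; rewrite inE => /andP[_ /eqP].
have u0_inj : injective u0.
  move=> x y e; have /f_inj xy : f (porbit s x) = f (porbit s y).
    by rewrite -!rtP -(porbit_perm t (ix x) (rt x)) -/(u0 x) e porbit_perm.
  rewrite (ixP x) (ixP y) (rs_eq _ _ xy); apply/eqP.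
  rewrite eq_permX_porbit -card_rt -eq_permX_porbit; apply/eqP.
  by rewrite -(rt_eq _ _ xy) -/(u0 x) e /u0 (rt_eq _ _ xy).
exists (perm u0_inj); apply/permP => y; rewrite -(permKV (perm u0_inj) y).
move: ((perm u0_inj)^-1%g y) => x; rewrite permJ !permE {1}/u0.
have sx : porbit s (s x) = porbit s x by have := porbit_perm s 1 x; rewrite expg1.
rewrite /u0 (rt_eq _ _ sx) -permM -expgSr; apply/eqP.
rewrite eq_permX_porbit card_rt -eq_permX_porbit expgSr permM -ixP.
by rewrite -(rs_eq _ _ sx) -ixP.
Qed.

End CycleConjugacy.

Lemma eq_nth_count s t q : 0 < q -> (forall i, nth 0 s i = nth 0 t i) ->
  count_mem q s = count_mem q t.
Proof.
move=> q0; have zero u : (forall i, nth 0 u i = 0) -> count_mem q u = 0.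
  move=> u0; apply/count_memPn/(nthP 0) => -[i _]; rewrite u0 => e.
  by rewrite -e in q0.
elim: s t => [|a s IH] [|b t] // e.
- by rewrite [RHS]zero // => i; rewrite -e nth_nil.
- by rewrite [LHS]zero // => i; rewrite e nth_nil.
by have /= -> := e 0; rewrite (IH t) // => i; apply: (e i.+1).
Qed.

Lemma sumn_take_nth s m : sumn (take m s) = \sum_(i < m) nth 0 s i.
Proof.
elim: m s => [|m IH] [|a s]; rewrite ?big_ord0 //=; last by rewrite big_ord_recl IH.
by rewrite big1 // => i _; rewrite nth_nil.
Qed.

(** Only the values of [nth] with default 0 are kept, since L may be longer or shorter than the n
    entries of an [intpart]. *)
Lemma intpart_of_seq n (L : seq nat) : sorted geq L -> sumn L = n ->
  exists j : intpart n, forall i, nth 0 (map val (val j)) i = nth 0 L i.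
Proof.
move=> Ls Ln; have mono i j : i <= j -> nth 0 L j <= nth 0 L i.
  exact: sorted_geq_nth.
have le m : \sum_(i < m) nth 0 L i <= n.
  by rewrite -sumn_take_nth -[in leqRHS]Ln -[in leqRHS](cat_take_drop m L)
    sumn_cat leq_addr.
(* A positive entry at index n or later would make the first n + 1 entries positive, with sum above
   n. *)
have big i : n <= i -> nth 0 L i = 0.
  move=> ni; apply/eqP; rewrite eqn0Ngt; apply/negP => pos.
  have := le n.+1; rewrite leqNgt => /negP; apply.
  rewrite -[X in X < _]card_ord -sum1_card big_ord_recr /= -addn1 leq_add //.
    by apply: leq_sum => a _; rewrite (leq_trans pos) // mono // ltnW //
      (leq_trans (ltn_ord a)).
  by rewrite (leq_trans pos) // mono.
have lt i : nth 0 L i < n.+1.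
  by have := le i.+1; rewrite big_ord_recr /= ltnS; apply: leq_trans;
    rewrite leq_addl.
pose j := [tuple inord (nth 0 L i) : 'I_n.+1 | i < n].
have jE : map val j = mkseq (nth 0 L) n.
  apply: (@eq_from_nth _ 0); first by rewrite size_map size_tuple size_mkseq.
  move=> i; rewrite size_map size_tuple => ilt.
  rewrite (nth_map ord0) ?size_tuple // nth_mkseq // -[i]/(val (Ordinal ilt)).
  by rewrite -tnth_nth tnth_mktuple /= inordK.
have jn i : nth 0 (map val j) i = nth 0 L i.
  rewrite jE; have [ilt|ni] := ltnP i n; first by rewrite nth_mkseq.
  by rewrite nth_default ?size_mkseq // big.
have jP : sorted geq (map val j) && (sumn (map val j) == n).
  apply/andP; split.
    rewrite jE; apply/(sortedP 0) => i; rewrite size_mkseq => ilt.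
    by rewrite !nth_mkseq ?(ltnW ilt) //; apply: mono.
  rewrite -(take_oversize (n := maxn n (size L)) (s := map val j)); last first.
    by rewrite size_map size_tuple leq_maxl.
  rewrite sumn_take_nth; under eq_bigr do rewrite jn.
  by rewrite -sumn_take_nth take_oversize ?Ln // leq_maxr.
by exists (exist _ j jP).
Qed.

Section CycleType.

Variables (n : nat).
Implicit Types (s : 'S_n) (j : intpart n).

Lemma mem_porbits_eq s X x : X \in porbits s -> (x \in X) = (porbit s x == X).
Proof. by case/imsetP => y _ ->; rewrite eq_porbit_mem. Qed.

Lemma conj_classP s j :
  reflect (forall q, 0 < q -> #|cycles_of_size s q| = npart j q)
    (s \in conj_class j).
Proof.
rewrite inE; apply: (iffP forallP) => [H q q0|H q]; last first.
  by apply/implyP => q0; rewrite -H.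
have [qn|nq] := ltnP q n.+1; first by have := H (Ordinal qn); rewrite /= q0 => /eqP.
rewrite /npart (count_memPn _); last first.
  by apply/mapP => -[x _ e]; rewrite e leqNgt ltn_ord in nq.
apply/eqP; rewrite cards_eq0; apply/eqP/setP => X; rewrite !inE.
apply/negP => /andP[_ /eqP Xq]; have := max_card X.
by rewrite card_ord Xq leqNgt nq.
Qed.

Lemma cycle_type_exists s : exists j, s \in conj_class j.
Proof.
pose L := sort geq [seq #|X| | X : {set 'I_n} in porbits s].
have [||j jL] := @intpart_of_seq n L.
- by apply: sort_sorted => a b; apply: leq_total.
- rewrite (perm_sumn (permEl (perm_sort _ _))) sumnE big_map big_enum_cond /=.
  rewrite -[RHS]card_ord -sum1_card (partition_big (porbit s) (mem (porbits s)))
    /=; last first.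
    by move=> x _; apply: imset_f.
  apply: eq_big => X; first by rewrite andbT.
  rewrite andbT => Xs; rewrite -sum1_card; apply: eq_bigl => x.
  exact: mem_porbits_eq.
exists j; apply/conj_classP => q q0.
rewrite /npart (eq_nth_count q0 jL) (seq.permP (permEl (perm_sort _ _))) count_map.
rewrite -sum1_card -sum1_count big_enum_cond /=; apply: eq_bigl => X.
by rewrite inE.
Qed.

Lemma cycle_type_fun :
  exists ty : 'S_n -> intpart n, forall s, s \in conj_class (ty s).
Proof.
apply: fin_all_exists (fun s j => s \in conj_class j) _ => s.
exact: cycle_type_exists.
Qed.

(** The class fixes the multiplicity of every positive part. The number of zeros follows because
    both lists have n entries, and sorted lists with equal multiplicities coincide. *)
Lemma cycle_type_unique s j j' : s \in conj_class j -> s \in conj_class j' ->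
  j = j'.
Proof.
move=> /conj_classP sj /conj_classP sj'; apply: val_inj; apply: val_inj.
apply: (inj_map val_inj); have [/andP[js _] /andP[js' _]] := (valP j, valP j').
have tr : transitive geq by move=> a b c ab bc; apply: leq_trans bc ab.
have asym : antisymmetric geq by move=> a b; rewrite andbC => /anti_leq.
apply: (sorted_eq tr asym js js').
move: js js' {sj sj'} (fun q q0 => etrans (esym (sj q q0)) (sj' q q0));
  rewrite /npart.
set a := map _ _; set b := map _ _ => _ _ ab.
have sz : size a = size b by rewrite !size_map !size_tuple.
have pf : perm_eq [seq x <- a | predC1 0 x] [seq x <- b | predC1 0 x].
  apply/allP => y _ /=; apply/eqP; rewrite !count_filter.
  have [->|y0] := posnP y; first by rewrite !(@eq_count _ _ pred0) ?count_pred0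
    // => z /=; case: eqP.
  by rewrite !(@eq_count _ _ (pred1 y)) ?ab // => z /=; case: eqP => // ->;
    rewrite -lt0n.
have z c : [seq x <- c | predC (predC1 0) x] =
  nseq (size c - size [seq x <- c | predC1 0 x]) 0.
  rewrite -(count_predC (predC1 0) c) size_filter addKn -size_filter.
  by apply/all_pred1P; apply/allP => y; rewrite mem_filter /= negbK => /andP[].
rewrite -(perm_filterC (predC1 0) a) perm_sym -(perm_filterC (predC1 0) b) perm_sym.
by rewrite !z sz (perm_size pf) perm_cat2r.
Qed.

Lemma conj_class_conj s t j : s \in conj_class j -> t \in conj_class j ->
  exists u, t = (s ^ u)%g.
Proof.
move=> /conj_classP sj /conj_classP tj.
by apply: conj_of_cycle_sizes => q q0; rewrite sj // tj.
Qed.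

End CycleType.

Local Open Scope ring_scope.

(** * Young symmetrizers *)

(** One notion for the row and column stabilizers of a diagram and for the Young subgroup of a
    coloring. *)
Definition stab n (f : 'I_n -> nat) : {set 'S_n} :=
  [set p : 'S_n | [forall i, f (p i) == f i]].

Lemma stabP n (f : 'I_n -> nat) (p : 'S_n) :
  reflect (forall i, f (p i) = f i) (p \in stab f).
Proof. by rewrite inE; apply: (iffP forallP) => fp i; apply/eqP. Qed.

Lemma stab1 n (f : 'I_n -> nat) : 1%g \in stab f.
Proof. by apply/stabP => i; rewrite perm1. Qed.

Lemma stabM n (f : 'I_n -> nat) p q :
  p \in stab f -> q \in stab f -> (p * q)%g \in stab f.
Proof. by move=> /stabP fp /stabP fq; apply/stabP => i; rewrite permM fq fp. Qed.

Lemma stabV n (f : 'I_n -> nat) p : (p^-1%g \in stab f) = (p \in stab f).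
Proof.
wlog suff V : p / p \in stab f -> p^-1%g \in stab f.
  by apply/idP/idP => /V; rewrite ?invgK.
by move=> /stabP fp; apply/stabP => i; rewrite -fp permKV.
Qed.

Lemma stabMl n (f : 'I_n -> nat) p q :
  p \in stab f -> ((p * q)%g \in stab f) = (q \in stab f).
Proof.
move=> fp; apply/idP/idP => [fpq|]; last exact: stabM.
by rewrite -(mulKg p q) stabM ?stabV.
Qed.

Lemma stabMr n (f : 'I_n -> nat) p q :
  q \in stab f -> ((p * q)%g \in stab f) = (p \in stab f).
Proof.
move=> fq; apply/idP/idP => [fpq|fp]; last exact: stabM.
by rewrite -(mulgK q p) stabM ?stabV.
Qed.

Lemma card_stab_gt0 n (f : 'I_n -> nat) : (0 < #|stab f|)%N.
Proof. by apply/card_gt0P; exists 1%g; apply: stab1. Qed.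

Section Representation.

Variables (F : fieldType) (n d : nat).
Variable rho : mx_representation F [set: 'S_n] d.

Definition rsum (f : 'I_n -> nat) : 'M[F]_d := \sum_(p in stab f) rho p.
Definition csum (f : 'I_n -> nat) : 'M[F]_d :=
  \sum_(q in stab f) (-1) ^+ q *: rho q.

Lemma rhoM x y : rho (x * y)%g = rho x *m rho y.
Proof. by rewrite repr_mxM ?inE. Qed.

Lemma rho1 : rho 1%g = 1%:M.
Proof. exact: repr_mx1. Qed.

Lemma rho_rsum f p : p \in stab f -> rho p *m rsum f = rsum f.
Proof.
move=> fp; rewrite /rsum mulmx_sumr [RHS](reindex_inj (mulgI p)) /=.
by apply: eq_big => [q|q _]; rewrite ?stabMl // rhoM.
Qed.

Lemma csum_rho f q : q \in stab f -> csum f *m rho q = (-1) ^+ q *: csum f.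
Proof.
move=> fq; rewrite /csum mulmx_suml scaler_sumr [RHS](reindex_inj (mulIg q)) /=.
apply: eq_big => [p|p _]; first by rewrite stabMr.
by rewrite -scalemxAl rhoM scalerA odd_permM signr_addb mulrCA -expr2 sqrr_sign
  mulr1.
Qed.

Lemma rsum_sqr f : rsum f *m rsum f = #|stab f|%:R *: rsum f.
Proof.
rewrite {1}/rsum mulmx_suml (eq_bigr (fun=> rsum f)) => [|p fp];
  last exact: rho_rsum.
by rewrite sumr_const scaler_nat.
Qed.

Lemma mul_sum_rho (I : finType) (P : pred I) (c : I -> F) (y : I -> 'S_n)
    (A B : 'M[F]_d) (k : 'S_n -> F) C :
  (forall y, A *m rho y *m B = k y *: C) ->
  A *m (\sum_(i | P i) c i *: rho (y i)) *m B = (\sum_(i | P i) c i * k (y i)) *: C.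
Proof.
move=> AB; rewrite mulmx_sumr mulmx_suml scaler_suml.
by apply: eq_bigr => i _; rewrite -scalemxAr -scalemxAl AB scalerA.
Qed.

Hypothesis char2 : (2%:R : F) != 0.

Lemma opp_eq0 (V : lmodType F) (x : V) : x = - x -> x = 0.
Proof.
move/eqP; rewrite -addr_eq0 -mulr2n -scaler_nat scaler_eq0 (negPf char2) /=.
by move/eqP.
Qed.

(* The transposition of x1 and x2 changes the sign of the column sum, and its
   conjugate by y is absorbed by the row sum. *)
Lemma csum_rho_rsum_eq0 (col g : 'I_n -> nat) (y : 'S_n) x1 x2 :
    x1 != x2 -> col x1 = col x2 -> g (y x1) = g (y x2) ->
  csum col *m rho y *m rsum g = 0.
Proof.
move=> x12 c12 g12; pose t := tperm x1 x2; apply: opp_eq0.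
have tC : t \in stab col.
  by apply/stabP => i; rewrite /t; case: tpermP => [->|->|].
have tR : (y^-1 * t * y)%g \in stab g.
  apply/stabP => i; rewrite !permM /t.
  by rewrite -[in RHS](permKV y i); case: tpermP => [->|->|].
rewrite -{1}(rho_rsum tR) mulmxA -(mulmxA _ (rho y)) -rhoM !mulgA mulgV mul1g
  rhoM mulmxA.
by rewrite (csum_rho tC) odd_tperm x12 expr1 scaleN1r !mulNmx.
Qed.

Section Young.

Variables (row col : 'I_n -> nat).
Hypothesis rc_inj : forall x y, row x = row y -> col x = col y -> x = y.
Hypothesis rc_closed :
  forall x i, (i <= row x)%N -> exists2 y, row y = i & col y = col x.

(** By [csum_rho_rsum_eq0] a nonzero product forces g o y to be injective on columns. Then
    [card_dominance] applies to g o y, whose level sets have the sizes of those of g. *)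
Lemma csum_rho_rsum_dom g (y : 'S_n) :
    csum col *m rho y *m rsum g != 0 ->
  forall m, (#|[set x | (g x < m)%N]| <= #|[set x | (row x < m)%N]|)%N.
Proof.
move=> nz m; have g_inj x1 x2 : g (y x1) = g (y x2) -> col x1 = col x2 -> x1 = x2.
  move=> g12 c12; apply/eqP; apply: contraNT nz => x12; apply/eqP.
  exact: csum_rho_rsum_eq0 g12.
have := card_dominance rc_closed g_inj m.
rewrite -(card_imset _ (@perm_inj _ y)).
rewrite (_ : y @: _ = [set x | (g x < m)%N]) //.
apply/setP => x; rewrite inE; apply/imsetP/idP => [[z]|gx].
  by rewrite inE => ? ->.
by exists ((y^-1)%g x); rewrite ?inE permKV.
Qed.

(** The coefficient of y in the Young symmetrizer, as an element of the group algebra. *)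
Definition young_coef (y : 'S_n) : F :=
  \sum_(q in stab col) \sum_(p in stab row) (-1) ^+ q * ((q * p)%g == y)%:R.

(** The column sum comes first because [young_symmetrizer] is made of products [q * p] with q a
    column permutation. *)
Definition young : 'M[F]_d := csum col *m rsum row.

Lemma youngE :
  young = \sum_(q in stab col) \sum_(p in stab row) (-1) ^+ q *: rho (q * p)%g.
Proof.
rewrite /young /csum mulmx_suml; apply: eq_bigr => q _.
by rewrite -scalemxAl mulmx_sumr scaler_sumr; apply: eq_bigr => p _; rewrite rhoM.
Qed.

(** The product determines q: the column of q x is that of x, and its row is that of p (q x). *)
Lemma row_col_stab_eq q p q' p' : q \in stab col -> p \in stab row ->
    q' \in stab col -> p' \in stab row ->
  ((q * p)%g == (q' * p')%g) = (q == q') && (p == p').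
Proof.
move=> /stabP qC /stabP pR /stabP q'C /stabP p'R.
apply/eqP/andP => [E|[/eqP-> /eqP->] //].
have qq' : q = q'.
  apply/permP => x; apply: rc_inj; last by rewrite qC q'C.
  by rewrite -pR -[RHS]p'R -!permM E.
by rewrite qq' eqxx; split=> //; apply/eqP/(mulgI q'); rewrite -E qq'.
Qed.

Lemma young_coef_mul q p : q \in stab col -> p \in stab row ->
  young_coef (q * p)%g = (-1) ^+ q.
Proof.
move=> qC pR; rewrite /young_coef (bigD1 q) //= [X in _ + X]big1 ?addr0.
  rewrite (bigD1 p) //= eqxx mulr1 [X in _ + X]big1 ?addr0 // => p' /andP[p'R pp'].
  by rewrite row_col_stab_eq // (negPf pp') andbF mulr0.
move=> q' /andP[q'C qq']; rewrite big1 // => p' p'R.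
by rewrite row_col_stab_eq // (negPf qq') mulr0.
Qed.

Lemma young_coef1 : young_coef 1%g = 1.
Proof. by rewrite -(mulg1 1%g) young_coef_mul ?stab1 // odd_perm1. Qed.

(** If y sends two points of one column to one row, both sides vanish. Otherwise [column_perm]
    writes y as a column permutation followed by a row permutation; these are absorbed by the two
    sums, leaving a sign. *)
Lemma csum_rho_rsum (y : 'S_n) :
  csum col *m rho y *m rsum row = young_coef y *: young.
Proof.
have [/existsP[x1 /existsP[x2 /and3P[x12 /eqP c12 /eqP r12]]]|N] := boolP
    [exists x1, exists x2,
       [&& x1 != x2, col x1 == col x2 & row (y x1) == row (y x2)]].
  rewrite (csum_rho_rsum_eq0 x12 c12 r12) /young_coef big1 ?scale0r //.
  move=> q /stabP qC.
  rewrite big1 // => p /stabP pR; case: eqP => [E|]; last by rewrite mulr0.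
  case/negP: x12; apply/eqP/(@perm_inj _ q)/rc_inj; last by rewrite !qC.
  by rewrite -pR -[RHS]pR -!permM E.
have y_inj x1 x2 : row (y x1) = row (y x2) -> col x1 = col x2 -> x1 = x2.
  move=> r12 c12; apply/eqP; apply: contraNT N => x12.
  by apply/existsP; exists x1; apply/existsP; exists x2; rewrite x12 r12 c12 !eqxx.
have [|q qC qR] := column_perm rc_closed y_inj.
  move=> m; rewrite -[LHS](card_imset _ (@perm_inj _ y)).
  apply: eq_card => x; rewrite inE; apply/imsetP/idP => [[z]|gx].
    by rewrite inE => ? ->.
  by exists ((y^-1)%g x); rewrite ?inE permKV.
have {}qC : q \in stab col by apply/stabP.
have pR : (q * y)%g \in stab row by apply/stabP => x; rewrite permM qR.
have -> : y = (q^-1 * (q * y))%g by rewrite mulKg.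
rewrite young_coef_mul ?stabV // rhoM mulmxA -mulmxA rho_rsum //.
by rewrite csum_rho ?stabV // -scalemxAl.
Qed.

(* The product of the hook lengths; only its being nonzero matters here. *)
Definition hook : F :=
  \sum_(p in stab row) \sum_(q in stab col) (-1) ^+ q * young_coef (p * q)%g.

(** Expand the middle factor into group elements and apply [csum_rho_rsum] to each. For y = 1 this
    computes the square of [young]; in general it shows that c y c is a multiple of c. *)
Lemma csum_rsum_csum_rsum y :
  csum col *m (rsum row *m rho y *m csum col) *m rsum row
  = (\sum_(p in stab row) \sum_(q in stab col)
       (-1) ^+ q * young_coef (p * y * q)%g) *: young.
Proof.
have -> : rsum row *m rho y *m csum col
    = \sum_(p in stab row) \sum_(q in stab col) (-1) ^+ q *: rho (p * y * q)%g.
  rewrite /rsum !mulmx_suml; apply: eq_bigr => p _.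
  by rewrite -rhoM mulmx_sumr; apply: eq_bigr => q _; rewrite -scalemxAr -rhoM.
move: (csum col) (rsum row) young csum_rho_rsum => A B C AB.
rewrite mulmx_sumr mulmx_suml scaler_suml; apply: eq_bigr => p _.
exact: mul_sum_rho AB.
Qed.

Lemma young_sqr : young *m young = hook *: young.
Proof.
have E := csum_rsum_csum_rsum 1%g; rewrite rho1 mulmx1 !mulmxA in E.
rewrite {2}/young mulmxA [LHS]E; congr (_ *: _).
by apply: eq_bigr => p _; apply: eq_bigr => q _; rewrite mulg1.
Qed.

Definition sandwich_coef (y : 'S_n) : F :=
  \sum_(p in stab row) \sum_(q in stab col) (-1) ^+ q * young_coef (p * y * q)%g.

Lemma young_rho_young y : young *m rho y *m young = sandwich_coef y *: young.
Proof. by rewrite -csum_rsum_csum_rsum /young !mulmxA. Qed.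

Lemma young_rho_rsum y : exists k, young *m rho y *m rsum row = k *: young.
Proof.
exists (\sum_(p in stab row) 1 * young_coef (p * y)%g).
rewrite -(mul_sum_rho _ _ _ csum_rho_rsum) /young -!mulmxA; congr (_ *m _).
rewrite mulmxA; congr (_ *m _).
by rewrite mulmx_suml; apply: eq_bigr => p _; rewrite scale1r rhoM.
Qed.

Lemma young_rsum : young *m rsum row = #|stab row|%:R *: young.
Proof. by rewrite -mulmxA rsum_sqr -scalemxAr. Qed.

End Young.

End Representation.

(** Factor A = C R through its rank. The hypothesis gives R C = h I, and C R has the same trace as R
    C. *)
Lemma mxtrace_quasi_idem (F : fieldType) N (A : 'M[F]_N) h :
  A *m A = h *: A -> \tr A = h * (\rank A)%:R.
Proof.
have := row_base_free A; have := col_base_full A; move: (mulmx_base A).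
move: (col_base A) (row_base A); move: (\rank A) => r C R <-.
move=> /row_fullP[L LC] /row_freeP[T RT] AA.
have RC : R *m C = h%:M.
  have <- : L *m (C *m R *m (C *m R)) *m T = R *m C.
    by rewrite !mulmxA LC mul1mx -(mulmxA (R *m C)) RT mulmx1.
  by rewrite AA -scalemxAr -scalemxAl mulmxA LC mul1mx RT scalemx1.
by rewrite mxtrace_mulC RC mxtrace_scalar mulr_natr.
Qed.

Section Span.

Variables (F : fieldType) (n d : nat).
Variable rho : mx_representation F [set: 'S_n] d.

Definition gr (x : 'S_n -> F) : 'M[F]_d := \sum_g x g *: rho g.

Lemma rsum_gr f : rsum rho f = gr (fun g => (g \in stab f)%:R).
Proof.
rewrite /gr /rsum [RHS](bigID (fun g => g \in stab f)) /= [X in _ + X]big1 ?addr0.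
  by apply: eq_bigr => g ->; rewrite scale1r.
by move=> g /negPf->; rewrite scale0r.
Qed.

Lemma young_gr row col : young rho row col = gr (young_coef F row col).
Proof.
rewrite youngE /gr /young_coef; under [RHS]eq_bigr do rewrite scaler_suml.
rewrite [RHS]exchange_big; apply: eq_bigr => q _ /=.
under [RHS]eq_bigr do rewrite scaler_suml.
rewrite [RHS]exchange_big; apply: eq_bigr => p _ /=.
rewrite (bigD1 (q * p)%g) //= eqxx mulr1 big1 ?addr0 // => g gqp.
by rewrite eq_sym (negPf gqp) mulr0 scale0r.
Qed.

End Span.

(** * The trace form of the group algebra *)

Section Regular.

Variables (F : fieldType) (n : nat).
Hypothesis charF0 : [pchar F] =i pred0.

Local Notation Sn := [set: 'S_n].
Local Notation R := (regular_repr F Sn).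
Local Notation idx := (gring_index Sn).
Local Notation N := #|Sn|.

Lemma natF_neq0 m : (0 < m)%N -> (m%:R : F) != 0.
Proof. by move=> m0; rewrite (proj1 (pcharf0P F) charF0) -lt0n. Qed.

Lemma char2 : (2%:R : F) != 0. Proof. exact: natF_neq0. Qed.

Lemma idx_bij : bijective idx.
Proof.
by exists enum_val => [u|i]; [rewrite gring_indexK ?inE | rewrite gring_valK].
Qed.

Lemma regE g x u : R g (idx x) (idx u) = ((x * g)%g == u)%:R.
Proof.
rewrite /= mxE mxE eqxx /= gring_indexK ?inE // eq_sym.
by rewrite (inj_eq (bij_inj idx_bij)).
Qed.

(** In the regular representation the row of the identity lists the coefficients of a group algebra
    element. *)
Lemma gr_reg x u : gr R x (idx 1) (idx u) = x u.
Proof.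
rewrite /gr summxE (bigD1 u) //= mxE regE mul1g eqxx mulr1 big1 ?addr0 // => g gu.
by rewrite mxE regE mul1g (negPf gu) mulr0.
Qed.

Lemma mul_regE (A : 'M[F]_N) g i u : (A *m R g) i (idx (u * g)%g) = A i (idx u).
Proof.
rewrite mxE (reindex idx); last exact: onW_bij idx_bij.
rewrite (bigD1 u) //= [X in X + _](_ : _ = A i (idx u)); last first.
  by rewrite [R g]lock -lock regE eqxx mulr1.
rewrite big1 ?addr0 // => x xu; have /= -> := regE g x (u * g)%g.
by rewrite (inj_eq (mulIg g)) (negPf xu) mulr0.
Qed.

(* The trace of u |-> A u Y on the group algebra. *)
Definition bform (A Y : 'M[F]_N) : F := \sum_u (A *m R u *m Y) (idx 1) (idx u).

Lemma bform_group g h : bform (R g) (R h) = \sum_(u : 'S_n) ((g * u * h)%g == u)%:R.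
Proof.
by apply: eq_bigr => u _; rewrite -!rhoM regE mul1g.
Qed.

Lemma bform_group_sym g h : bform (R g) (R h) = bform (R h) (R g).
Proof.
rewrite !bform_group (reindex_inj invg_inj) /=; apply: eq_bigr => u _.
congr (nat_of_bool _)%:R; rewrite -(inj_eq invg_inj) !invMg !invgK.
rewrite -(inj_eq (mulgI h)) !mulgA mulgV mul1g -(inj_eq (mulIg g)) -!mulgA mulVg
  mulg1.
by rewrite eq_sym.
Qed.

(** Substitute [u * g] for u. This is what makes g |-> [bform A (R g)] a class function. *)
Lemma bform_cyc A Y g : bform A (Y *m R g) = bform A (R g *m Y).
Proof.
rewrite /bform (reindex_inj (mulIg g)) /=; apply: eq_bigr => u _.
by rewrite !mulmxA mul_regE rhoM !mulmxA.
Qed.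

Lemma bform_suml (I : finType) (P : pred I) (c : I -> F) (A : I -> 'M[F]_N) Y :
  bform (\sum_(i | P i) c i *: A i) Y = \sum_(i | P i) c i * bform (A i) Y.
Proof.
rewrite /bform; under [RHS]eq_bigr do rewrite mulr_sumr.
rewrite [RHS]exchange_big; apply: eq_bigr => u _ /=.
rewrite !mulmx_suml summxE; apply: eq_bigr => i _.
by rewrite -!scalemxAl mxE.
Qed.

Lemma bform_sumr (I : finType) (P : pred I) (c : I -> F) A (Y : I -> 'M[F]_N) :
  bform A (\sum_(i | P i) c i *: Y i) = \sum_(i | P i) c i * bform A (Y i).
Proof.
rewrite /bform; under [RHS]eq_bigr do rewrite mulr_sumr.
rewrite [RHS]exchange_big; apply: eq_bigr => u _ /=.
rewrite !mulmx_sumr summxE; apply: eq_bigr => i _.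
by rewrite -!scalemxAr mxE.
Qed.

Lemma bform_gr x y :
  bform (gr R x) (gr R y) = \sum_g \sum_h x g * y h * bform (R g) (R h).
Proof.
rewrite bform_suml; apply: eq_bigr => g _.
rewrite bform_sumr mulr_sumr; apply: eq_bigr => h _; exact: mulrA.
Qed.

Lemma bform_sym x y : bform (gr R x) (gr R y) = bform (gr R y) (gr R x).
Proof.
rewrite !bform_gr exchange_big; apply: eq_bigr => g _; apply: eq_bigr => h _.
by rewrite bform_group_sym mulrC (mulrC (x h)) mulrC.
Qed.

Lemma bform_cyc_gr A Y x : bform A (Y *m gr R x) = bform A (gr R x *m Y).
Proof.
have -> : Y *m gr R x = \sum_g x g *: (Y *m R g).
  by rewrite mulmx_sumr; apply: eq_bigr => g _; rewrite -scalemxAr.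
have -> : gr R x *m Y = \sum_g x g *: (R g *m Y).
  by rewrite mulmx_suml; apply: eq_bigr => g _; rewrite -scalemxAl.
by rewrite !bform_sumr; apply: eq_bigr => g _; rewrite bform_cyc.
Qed.

Lemma reg_trace g : \tr (R g) = (n`!)%:R * (g == 1%g)%:R.
Proof.
rewrite /mxtrace (reindex idx); last exact: onW_bij idx_bij.
under eq_bigr => x _ do rewrite regE -(inj_eq (mulgI x^-1%g)) mulKg mulVg.
by rewrite sumr_const card_Sn mulr_natl.
Qed.

Section OneDiagram.

Variables (row col : 'I_n -> nat).
Hypothesis rc_inj : forall x y, row x = row y -> col x = col y -> x = y.
Hypothesis rc_closed :
  forall x i, (i <= row x)%N -> exists2 y, row y = i & col y = col x.

Local Notation c := (young R row col).
Local Notation cf := (young_coef F row col).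
Local Notation h := (hook F row col).

Lemma young_reg u : c (idx 1) (idx u) = cf u.
Proof. by rewrite young_gr gr_reg. Qed.

Lemma young_reg1 : c (idx 1) (idx 1) = 1.
Proof. by rewrite young_reg young_coef1. Qed.

(* The trace of c on the group algebra is n!. *)
Lemma hook_neq0 : h != 0.
Proof.
have := mxtrace_quasi_idem (young_sqr R char2 rc_inj rc_closed).
have -> : \tr c = (n`!)%:R.
  rewrite young_gr raddf_sum /= (bigD1 1%g) //= mxtraceZ reg_trace eqxx mulr1.
  rewrite young_coef1 // mul1r big1 ?addr0 // => g g1.
  by rewrite mxtraceZ reg_trace (negPf g1) !mulr0.
move=> E; apply: contra_neq (natF_neq0 (fact_gt0 n)) => h0.
by rewrite E h0 mul0r.
Qed.

(** If c u Y = k_u c, its coefficient at u is k_u times that of c, and k_u is its coefficient at 1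
    because c has coefficient 1 there. So the trace is the coefficient at 1 of c Y with u replaced
    by c in the middle, that is, of c c Y. *)
Lemma bform_young Y : (forall u, exists k, c *m R u *m Y = k *: c) ->
  bform c Y = (c *m c *m Y) (idx 1) (idx 1).
Proof.
have Z k (A : 'M[F]_N) i j : (k *: A) i j = k * A i j by rewrite mxE.
move=> cY; rewrite {3}young_gr /gr mulmx_sumr mulmx_suml summxE.
apply: eq_bigr => u _; rewrite -scalemxAr -scalemxAl Z.
by have [k ->] := cY u; rewrite !Z young_reg1 young_reg mulr1 mulrC.
Qed.

Lemma bform_young_young : bform c c = h ^+ 2.
Proof.
rewrite bform_young => [|u]; last first.
  by exists (sandwich_coef F row col u); rewrite young_rho_young // char2.
rewrite young_sqr ?char2 // -scalemxAl young_sqr ?char2 //.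
by rewrite scalerA mxE young_reg1 mulr1.
Qed.

Lemma bform_young_rsum : bform c (rsum R row) = h * #|stab row|%:R.
Proof.
rewrite bform_young => [|u]; last by apply: young_rho_rsum => //; apply: char2.
rewrite young_sqr ?char2 // -scalemxAl young_rsum.
by rewrite scalerA mxE young_reg1 mulr1.
Qed.

(** Expanding the row sum of c, the product c u involves the column sum times the elements [p * u].
    One of them survives multiplication by [rsum R g], and [csum_rho_rsum_dom] applies to it. *)
Lemma bform_young_mulrsum_dom g Y : bform c (rsum R g *m Y) != 0 ->
  forall m, (#|[set x | (g x < m)%N]| <= #|[set x | (row x < m)%N]|)%N.
Proof.
move=> nz m.
have [/existsP[y]|/existsPn no] :=
    boolP [exists y, csum R col *m R y *m rsum R g != 0].
  by move/(csum_rho_rsum_dom char2 rc_closed); apply.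
case/eqP: nz; rewrite /bform big1 // => u _.
suff -> : c *m R u *m (rsum R g *m Y) = 0 by rewrite mxE.
rewrite mulmxA; suff -> : c *m R u *m rsum R g = 0 by rewrite mul0mx.
rewrite /young -(mulmxA (csum _ _)).
suff -> : rsum R row *m R u = \sum_(p in stab row) R (p * u)%g.
  move: (csum R col) (rsum R g) no => A C no.
  rewrite mulmx_sumr mulmx_suml big1 // => p _.
  by apply/eqP; have := no (p * u)%g; rewrite negbK.
by rewrite /rsum mulmx_suml; apply: eq_bigr => p _; rewrite rhoM.
Qed.

Lemma bform_young_rsum_dom g : bform c (rsum R g) != 0 ->
  forall m, (#|[set x | (g x < m)%N]| <= #|[set x | (row x < m)%N]|)%N.
Proof.
by move=> nz; apply: (@bform_young_mulrsum_dom _ 1%:M); rewrite mulmx1.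
Qed.

(** The trace form allows the row sum of the second symmetrizer to be moved in front of its column
    sum. *)
Lemma bform_young_young_dom row' col' : bform c (young R row' col') != 0 ->
  forall m, (#|[set x | (row' x < m)%N]| <= #|[set x | (row x < m)%N]|)%N.
Proof.
rewrite [X in bform _ X]/young [rsum R row']rsum_gr bform_cyc_gr -rsum_gr.
exact: bform_young_mulrsum_dom.
Qed.

End OneDiagram.

End Regular.

(** * The Pieri rule *)

Lemma big_involution_eq0 (F : fieldType) (I : finType) (P : pred I) (g : I -> F)
    (iota : I -> I) :
    (2%:R : F) != 0 -> (forall x, P x -> P (iota x)) ->
    (forall x, P x -> iota (iota x) = x) ->
    (forall x, P x -> g (iota x) = - g x) ->
  \sum_(x | P x) g x = 0.
Proof.
move=> two Pi ii gi; set S := \sum_(x | P x) g x.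
have E : S = - S.
  rewrite {1}/S (reindex_onto iota iota ii) -sumrN.
  apply: eq_big => [x|x /andP[Px /eqP xx]]; last by rewrite gi // -xx Pi.
  apply/andP/idP => [[Px /eqP <-]|Px]; first exact: Pi.
  by rewrite Pi // ii.
have : 2%:R * S = 0 by rewrite mulr_natl mulr2n {1}E addNr.
by move/eqP; rewrite mulf_eq0 (negPf two) => /eqP.
Qed.

Section Pieri.

Variables (F : fieldType) (k : nat).
Hypothesis char2 : (2%:R : F) != 0.

Local Notation "m # s" := [multinom m (s i) | i < k]
  (at level 40, left associativity, format "m # s").

Definition hsym (r : nat) : {mpoly F[k]} :=
  \sum_(m : 'X_{1..k < r.+1} | mdeg m == r) 'X_[m].

Lemma mcoeff_sum_mdeg b r m : (r <= b)%N ->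
  (\sum_(x : 'X_{1..k < b.+1} | mdeg x == r) 'X_[x] : {mpoly F[k]})@_m
  = (mdeg m == r)%:R.
Proof.
move=> rb; rewrite raddf_sum /=; have [mr|mr] := eqVneq (mdeg m) r.
  have lt : (mdeg m < b.+1)%N by rewrite mr.
  rewrite (bigD1 (BMultinom lt)) /= ?mr // mcoeffX eqxx big1 ?addr0 // => x.
  case/andP=> _ xm; rewrite mcoeffX (_ : _ == m = false) //.
  by apply: contraNF xm => /eqP e; apply/eqP/val_inj.
rewrite big1 // => x xr; rewrite mcoeffX; case: eqP => // e.
by rewrite -e xr in mr.
Qed.

Lemma mcoeff_hsym r m : (hsym r)@_m = (mdeg m == r)%:R.
Proof. exact: mcoeff_sum_mdeg. Qed.

Lemma mcoeffM_hsym (f : {mpoly F[k]}) r l :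
  (f * hsym r)@_l
  = \sum_(x : 'X_{1..k < (mdeg l).+1} | (x <= l)%MM && (mdeg x + r == mdeg l)%N)
    f@_x.
Proof.
rewrite mcoeffM big_mkcond /=.
rewrite -(pair_bigA _ (fun x y : 'X_{1..k < (mdeg l).+1} =>
   if l == (x + y)%MM then f@_x * (hsym r)@_y else 0)) /=.
rewrite [RHS]big_mkcond; apply: eq_bigr => x _ /=.
have [xl|xl] := boolP (x <= l)%MM; last first.
  rewrite big1 // => y _; case: eqP => // e.
  by case/negP: xl; have := lem_addr x y; rewrite -e.
have lt : (mdeg (l - x)%MM < (mdeg l).+1)%N by rewrite ltnS mdegB.
have xy : (x + (l - x))%MM = l by rewrite addmC submK.
have dl : mdeg l = (mdeg x + mdeg (l - x)%MM)%N by rewrite -mdegD xy.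
have -> : (mdeg x + r == mdeg l)%N = (mdeg (l - x)%MM == r).
  by apply/eqP/eqP => [|<-]; rewrite -?dl // [RHS]dl => /addnI.
rewrite (bigD1 (BMultinom lt)) //= xy eqxx mcoeff_hsym.
rewrite big1 ?addr0 => [|y yl]; last first.
  case: eqP => // e; case/eqP: yl; apply: val_inj; rewrite /= [X in (X - _)%MM]e.
  by rewrite addmC addmK.
by case: eqP => _; rewrite ?mulr1 ?mulr0.
Qed.

Definition antisym (f : {mpoly F[k]}) :=
  forall i j : 'I_k, i != j -> msym (tperm i j) f = - f.

Lemma antisymM f g : antisym f -> (forall s, msym s g = g) -> antisym (f * g).
Proof. by move=> fA gS i j ij; rewrite msymM fA // gS mulNr. Qed.

Lemma hsym_sym r s : msym s (hsym r) = hsym r.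
Proof. by apply/mpolyP => m; rewrite mcoeff_sym !mcoeff_hsym mdeg_mperm. Qed.

Definition sdecr (l : 'X_{1..k}) := forall i j : 'I_k, (i < j)%N -> (l j < l i)%N.

Lemma sdecr_succ (l : 'X_{1..k}) :
  (forall i j : 'I_k, j = i.+1 :> nat -> (l j < l i)%N) -> sdecr l.
Proof.
move=> ls i j; move: {2}(j - i)%N (erefl (j - i)%N) => d.
elim: d j => [|d IH] j e ij; first by move/eqP: e; rewrite subn_eq0 leqNgt ij.
have jk : (j.-1 < k)%N by rewrite (leq_ltn_trans (leq_pred j)).
have j1 : j = (Ordinal jk).+1 :> nat by rewrite /= (ltn_predK ij).
have := ls _ _ j1; have [<- //|ne] := eqVneq i (Ordinal jk).
move/ltn_trans; apply; apply: IH => /=.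
  by rewrite -subn1 subnAC e subn1.
rewrite ltn_neqAle; have -> /= : (i <= j.-1)%N by rewrite -ltnS -j1.
by rewrite andbT; apply: contra_neq ne => e'; apply: val_inj.
Qed.

(* Exponents x with x_i <= l_(i+1) for some i cancel in pairs: swap x_i and
   x_(i+1) for the first such i. *)
Lemma pieri (f : {mpoly F[k]}) r l : antisym f -> sdecr l ->
    (f * hsym r)@_l != 0 ->
  exists x, [/\ f@_x != 0, (x <= l)%MM, (mdeg x + r = mdeg l)%N
    & forall i j : 'I_k, j = i.+1 :> nat -> (l j < x i)%N].
Proof.
move=> fA ld; rewrite mcoeffM_hsym.
pose bad (x : 'X_{1..k}) (u : 'I_k * 'I_k) :=
  (u.2 == u.1.+1 :> nat) && (x u.1 <= l u.2)%N.
pose bad1 x u := bad x u && [forall v : 'I_k * 'I_k, (v.1 < u.1)%N ==> ~~ bad x v].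
have bad1_uniq x u v : bad1 x u -> bad1 x v -> u = v.
  case: u v => [i j] [i' j'] /andP[/andP[/= /eqP j1 b] /forallP fb].
  move=> /andP[/andP[/= /eqP j1' b'] /forallP fb'].
  have ii' : i = i'.
    apply: val_inj; case: (ltngtP i i') => //= lt.
      by have := fb' (i, j); rewrite /= lt /bad /= j1 eqxx b.
    by have := fb (i', j'); rewrite /= lt /bad /= j1' eqxx b'.
  by congr (_, _) => //; apply: val_inj; rewrite /= j1 j1' ii'.
set P := (X in \sum_(x | X x) _) => nz.
have [/existsP[x /and3P[/andP[xl /eqP xd] fx ok]]|/existsPn N] := boolP
    [exists x : 'X_{1..k < (mdeg l).+1},
       [&& P x, f@_x != 0 & [forall u : 'I_k * 'I_k, ~~ bad x u]]].
  exists (x : 'X_{1..k}); split => // i j ji.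
  by have := forallP ok (i, j); rewrite /bad /= ji eqxx -ltnNge.
case/eqP: nz.
have badE x : P x -> f@_x != 0 -> exists u, bad1 x u.
  move=> Px fx; have := N x; rewrite Px fx /= => /forallPn[u]; rewrite negbK => bu.
  have [v bv vmin] := arg_minnP (fun u : 'I_k * 'I_k => u.1 : nat) bu.
  exists v; rewrite /bad1 bv; apply/forallP => w; apply/implyP => wv.
  by apply: contraL wv => /vmin; rewrite -leqNgt.
(* Swapping two exponents preserves the degree, so [insubd] never falls back to x. *)
pose sw (x : 'X_{1..k < (mdeg l).+1}) : 'X_{1..k < (mdeg l).+1} :=
  if [pick u | bad1 x u] is Some u
  then insubd x ((x : 'X_{1..k})#(tperm u.1 u.2)) else x.
have swE (x : 'X_{1..k < (mdeg l).+1}) u : bad1 x u ->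
  sw x = (x : 'X_{1..k})#(tperm u.1 u.2) :> 'X_{1..k}.
  move=> bu; rewrite /sw; case: pickP => [v bv|/(_ u)]; last by rewrite bu.
  by rewrite (bad1_uniq _ _ _ bv bu) insubdK // unfold_in /= mdeg_mperm bmdeg.
(* Since x_(i+1) <= l_(i+1) < l_i, the swap keeps x below l and the pair bad. Earlier pairs read
   only entries before i, so this pair stays the first bad one. *)
have bad_sw (x : 'X_{1..k < (mdeg l).+1}) u : bad1 x u -> (x <= l)%MM ->
  bad1 (sw x) u /\ (sw x <= l)%MM.
  case: u => i j bu; have xE := swE _ _ bu.
  case/andP: (bu) => /andP[/= /eqP ji b] /forallP fb /mnm_lepP xl.
  have ij : (i < j)%N by rewrite ji.
  split; last first.
    apply/mnm_lepP => p; rewrite xE mnmE; case: tpermP => [->|->|_ _] //.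
    by rewrite (leq_trans (xl j)) // ltnW // ld.
  rewrite /bad1 /bad xE /= ji eqxx mnmE tpermL xl /=.
  apply/forallP => -[p q]; apply/implyP => /= pi; apply/negP => /andP[/eqP qp].
  rewrite mnmE tpermD; last 2 first.
  - by rewrite neq_ltn pi orbT.
  - by rewrite neq_ltn (ltn_trans pi ij) orbT.
  by move=> xp; have := fb (p, q); rewrite /bad /= pi qp eqxx xp.
(* A bad pair is available only where f has a nonzero coefficient; the other terms vanish. *)
rewrite (bigID (fun x : 'X_{1..k < (mdeg l).+1} => f@_x == 0)) /=.
rewrite big1 ?add0r => [|x /andP[_ /eqP //]].
have fsw x : P x -> f@_x != 0 -> f@_(sw x) = - f@_x.
  move=> Px fx; have [[i j] bu] := badE x Px fx; rewrite (swE _ _ bu) /=.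
  rewrite -mcoeff_sym fA ?mcoeffN //.
  by case/andP: bu => /andP[/= /eqP ji _] _;
    rewrite -(inj_eq val_inj) /= ji neq_ltn ltnSn.
apply: (big_involution_eq0 (iota := sw)) => // [x|x|x] /andP[Px fx].
- have [u bu] := badE x Px fx; case/andP: (Px) => xl xd.
  rewrite /P fsw // oppr_eq0 fx andbT.
  by have [_ ->] := bad_sw _ _ bu xl; rewrite (swE _ _ bu) mdeg_mperm.
- have [u bu] := badE x Px fx; case/andP: (Px) => xl xd.
  have [bu' _] := bad_sw _ _ bu xl; apply: val_inj => /=.
  rewrite (swE _ _ bu') (swE _ _ bu); apply/mnmP => p.
  by rewrite !mnmE tpermK.
- exact: fsw.
Qed.

End Pieri.

Definition psum k (l : 'X_{1..k}) (m : nat) : nat := \sum_(p < k | (p < m)%N) l p.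

Lemma psum_inj k (l l' : 'X_{1..k}) : (forall m, psum l m = psum l' m) -> l = l'.
Proof.
move=> e; apply/mnmP => i; have S (x : 'X_{1..k}) :
  psum x i.+1 = (psum x i + x i)%N.
  rewrite /psum (bigD1 i) //= addnC; congr (_ + _)%N; apply: eq_bigl => p.
  by rewrite ltnS -(inj_eq val_inj) [RHS]ltn_neqAle andbC.
by have := e i.+1; rewrite !S e => /addnI.
Qed.

Lemma psum_total k (l : 'X_{1..k}) m :
  mdeg l = (psum l m + \sum_(p < k | (m <= p)%N) l p)%N.
Proof.
rewrite mdegE (bigID (fun p : 'I_k => (p < m)%N)) /=; congr (_ + _)%N.
by apply: eq_bigl => p; rewrite -leqNgt.
Qed.

Lemma psumD k (l l' : 'X_{1..k}) m : psum (l + l')%MM m = (psum l m + psum l' m)%N.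
Proof. by rewrite /psum -big_split; apply: eq_bigr => p _; rewrite mnmDE. Qed.

Lemma psum_le k (l l' : 'X_{1..k}) m : (l <= l')%MM -> (psum l m <= psum l' m)%N.
Proof. by move=> /mnm_lepP ll; apply: leq_sum => p _. Qed.

(** * The Vandermonde product and the iterated Pieri rule *)

Section Vandermonde.

Variables (F : fieldType) (k : nat).

(** The exponents of the Vandermonde product are the rearrangements of rho; the reversal in
    [perm_mnm] makes w = 1 give rho itself. *)
Definition rho_mnm : 'X_{1..k} := [multinom (k - p.+1)%N | p < k].
Definition perm_mnm (w : 'S_k) : 'X_{1..k} :=
  [multinom (w (rev_ord p) : nat) | p < k].

(** The factors of [det_Vandermonde] are later minus earlier, so the variables are taken in reverse
    order; then expand the determinant. *)
Lemma vandermonde_prodE : vandermonde_prod F k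
  = \sum_(w : 'S_k) (-1) ^+ w *: 'X_[perm_mnm w].
Proof.
transitivity (\det (Vandermonde k (\row_(j < k) ('X_(rev_ord j) : {mpoly F[k]})))).
  rewrite det_Vandermonde.
  under [RHS]eq_bigr do under eq_bigr do rewrite !mxE.
  rewrite /vandermonde_prod pair_big_dep /= [RHS]pair_big_dep /=.
  rewrite [RHS](reindex_inj (h := fun u : 'I_k * 'I_k =>
    (rev_ord u.2, rev_ord u.1))) /=.
    apply: eq_big => [[p q] /=|[p q] _ /=]; last by rewrite !rev_ordK.
    by apply/idP/idP; have := ltn_ord p; have := ltn_ord q; lia.
  move=> [p q] [p' q'] /= e; have /= /rev_ord_inj -> := congr1 fst e.
  by have /= /rev_ord_inj -> := congr1 snd e.
rewrite /determinant (reindex_inj invg_inj) /=; apply: eq_bigr => w _.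
rewrite odd_permV -[RHS]mul_mpolyC rmorphXn rmorphN rmorph1; congr (_ * _).
rewrite mpolyXE_id (reindex_inj (h := fun p => w (rev_ord p))) /=; last first.
  by move=> p q /perm_inj/rev_ord_inj.
by apply: eq_bigr => p _; rewrite !mxE permK rev_ordK mnmE.
Qed.

Lemma mcoeff_vandermonde m :
  (vandermonde_prod F k)@_m = \sum_(w : 'S_k) (-1) ^+ w * (perm_mnm w == m)%:R.
Proof.
by rewrite vandermonde_prodE raddf_sum /=; apply: eq_bigr => w _;
  rewrite mcoeffZ mcoeffX.
Qed.

Lemma perm_mnm_inj : injective perm_mnm.
Proof.
move=> w w' /mnmP e; apply/permP => p; apply: val_inj.
by have := e (rev_ord p); rewrite !mnmE rev_ordK.
Qed.

Lemma perm_mnm1 : perm_mnm 1 = rho_mnm.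
Proof. by apply/mnmP => p; rewrite !mnmE perm1. Qed.

Lemma mcoeff_vandermonde_rho : (vandermonde_prod F k)@_rho_mnm = 1.
Proof.
rewrite mcoeff_vandermonde (bigD1 1%g) //= perm_mnm1 eqxx odd_perm1 mulr1.
rewrite big1 ?addr0 // => w w1; rewrite -perm_mnm1 (inj_eq perm_mnm_inj) (negPf w1).
by rewrite mulr0.
Qed.

Lemma vandermonde_neq0E m : (vandermonde_prod F k)@_m != 0 ->
  exists w, m = perm_mnm w.
Proof.
have [/existsP[w /eqP ->] _|/existsPn N] := boolP [exists w, m == perm_mnm w].
  by exists w.
rewrite mcoeff_vandermonde big1 ?eqxx // => w _.
by rewrite eq_sym (negPf (N w)) mulr0.
Qed.

Lemma vandermonde_antisym : antisym (vandermonde_prod F k).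
Proof.
move=> i j ij; apply/mpolyP => m; rewrite mcoeffN mcoeff_sym !mcoeff_vandermonde.
set t := tperm (rev_ord i) (rev_ord j).
rewrite (reindex_inj (mulgI t)) /= -sumrN; apply: eq_bigr => w _.
rewrite odd_permM odd_tperm (inj_eq rev_ord_inj) ij addTb signrN mulNr.
have revt p : rev_ord (tperm i j p) = t (rev_ord p).
  case: tpermP => [->|->|/eqP pi /eqP pj]; rewrite /t ?tpermL ?tpermR //.
  by rewrite tpermD // eq_sym (inj_eq rev_ord_inj).
congr (- (_ * (nat_of_bool _)%:R)); apply/eqP/eqP => [/mnmP e|<-]; apply/mnmP => p.
  by have := e (tperm i j p); rewrite !mnmE tpermK => <-;
    rewrite permM revt /t tpermK.
by rewrite !mnmE permM revt.
Qed.

Lemma mdeg_perm_mnm w : mdeg (perm_mnm w) = mdeg rho_mnm.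
Proof.
rewrite -perm_mnm1 !mdegE (reindex_inj rev_ord_inj) /=.
rewrite [RHS](reindex_inj rev_ord_inj) /=
  [RHS](reindex_inj (@perm_inj _ w)) /=.
by apply: eq_bigr => p _; rewrite !mnmE !rev_ordK perm1.
Qed.

(** The left side adds values at m positions, the right side the m largest values. Values in A but
    not in T are below k - m, those in T but not in A are at least k - m, and there are equally many
    of each. *)
Lemma psum_perm_mnm w m : (psum (perm_mnm w) m <= psum rho_mnm m)%N.
Proof.
pose A := [set q : 'I_k | ((w^-1)%g q + m >= k)%N].
pose T := [set q : 'I_k | (q + m >= k)%N].
have SA : psum (perm_mnm w) m = (\sum_(q in A) q)%N.
  rewrite /psum [RHS](reindex_inj (h := fun p => w (rev_ord p))) /=; last first.
    by move=> p q /perm_inj/rev_ord_inj.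
  apply: eq_big => p; rewrite ?mnmE // inE permK /=; have := ltn_ord p; lia.
have ST : psum rho_mnm m = (\sum_(q in T) q)%N.
  rewrite -perm_mnm1 /psum [RHS](reindex_inj rev_ord_inj) /=.
  apply: eq_big => p; rewrite ?mnmE ?perm1 // inE /=; have := ltn_ord p; lia.
have AT : #|A| = #|T|.
  rewrite -(card_imset _ (@perm_inj _ (w^-1)%g)); apply: eq_card => q; rewrite inE.
  apply/imsetP/idP => [[x]|qT]; first by rewrite inE => ? ->.
  by exists (w q); rewrite ?inE permK.
rewrite SA ST (big_setID T) [leqRHS](big_setID A) /= setIC leq_add2l.
have DE : #|A :\: T| = #|T :\: A|.
  by apply/eqP; rewrite -(eqn_add2l #|A :&: T|) cardsID AT setIC cardsID.
apply: (@leq_trans (\sum_(q in A :\: T) (k - m))%N).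
  apply: leq_sum => q; rewrite !inE -ltnNge => /andP[qk _]; lia.
rewrite sum_nat_const DE -sum_nat_const; apply: leq_sum => q.
by rewrite !inE => /andP[_]; rewrite leq_subLR addnC.
Qed.

(** The start of the induction in [hprod_dom]: l_0 < k and strict decrease give l_p + p < k. *)
Lemma sdecr_tail l (p : 'I_k) : sdecr l -> (forall p : 'I_k, (l p < k)%N) ->
  (l p <= rho_mnm p)%N.
Proof.
move=> ld lk; suff H m : forall p : 'I_k, p = m :> nat -> (l p + m < k)%N.
  by have := H p p erefl; rewrite mnmE; lia.
elim: m => [|m IH] q qm; first by rewrite addn0.
have mk : (m < k)%N by rewrite ltnW // -qm.
have := IH (Ordinal mk) erefl; apply: leq_ltn_trans.
by rewrite addnS -addSn leq_add2r ld //= qm.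
Qed.

Definition hprod (mu : seq nat) : {mpoly F[k]} := \prod_(r <- mu) hsym F k r.

Lemma hprod_sym mu s : msym s (hprod mu) = hprod mu.
Proof.
rewrite /hprod rmorph_prod; apply: eq_bigr => r _; exact: hsym_sym.
Qed.

Hypothesis char2 : (2%:R : F) != 0.

(* By the Pieri rule each factor adds a horizontal strip, so after m factors the
   shape has at most m rows and mu_0 + ... + mu_(m-1) cells, and it is contained
   in the final one. *)
Lemma hprod_dom mu l : sdecr l -> (vandermonde_prod F k * hprod mu)@_l != 0 ->
  forall m, (psum rho_mnm m + sumn (take m mu) <= psum l m)%N.
Proof.
move=> ld nz.
suff [_ _ //] : [/\ mdeg l = (mdeg rho_mnm + sumn mu)%N,
   forall p : 'I_k, (size mu <= p)%N -> (l p <= rho_mnm p)%N &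
   forall m, (psum rho_mnm m + sumn (take m mu) <= psum l m)%N].
(* Once all factors are used, a prefix sum is the degree minus a tail, and the tail is at most that
   of rho. *)
have fin nu x : mdeg x = (mdeg rho_mnm + sumn nu)%N ->
   (forall p : 'I_k, (size nu <= p)%N -> (x p <= rho_mnm p)%N) ->
   forall m, (size nu <= m)%N -> (psum rho_mnm m + sumn (take m nu) <= psum x m)%N.
  move=> xd xt m sm; rewrite take_oversize //.
  rewrite -(leq_add2r (\sum_(p < k | (m <= p)%N) x p)%N).
  rewrite -psum_total xd [in leqRHS](psum_total _ m) addnAC leq_add2r leq_add2l.
  by apply: leq_sum => p mp; apply: xt; apply: leq_trans mp.
elim/last_ind: mu l ld nz => [|mu r IH] l ld.
  rewrite /hprod big_nil mulr1 => /vandermonde_neq0E[w lE].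
  have ldeg : mdeg l = (mdeg rho_mnm + sumn [::])%N
    by rewrite addn0 lE mdeg_perm_mnm.
  have ltl (p : 'I_k) : (0 <= p)%N -> (l p <= rho_mnm p)%N.
    by move=> _; apply: sdecr_tail => // q; rewrite lE mnmE.
  by split=> // m; apply: fin.
rewrite /hprod big_rcons /= -/(hprod mu).
rewrite mulrA => nz; have [|x [fx xl xd xg]] := pieri char2 _ ld nz.
  by apply: antisymM => [|s]; [apply: vandermonde_antisym | apply: hprod_sym].
have xsd : sdecr x.
  apply: sdecr_succ => i j ji; apply: leq_ltn_trans (xg i j ji).
  exact: (mnm_lepP xl).
have [xdeg xt xp] := IH x xsd fx.
have ldeg : mdeg l = (mdeg rho_mnm + sumn (rcons mu r))%N.
  by rewrite -xd xdeg sumn_rcons addnA.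
(* The strip condition gives l_p < x_(p-1) <= rho_(p-1) = rho_p + 1. *)
have lt (p : 'I_k) : (size (rcons mu r) <= p)%N -> (l p <= rho_mnm p)%N.
  rewrite size_rcons => sp.
  have pk : (p.-1 < k)%N by rewrite (leq_ltn_trans (leq_pred p)).
  have p1 : p = (Ordinal pk).+1 :> nat by rewrite /= (ltn_predK sp).
  have := leq_trans (xg _ _ p1) (xt (Ordinal pk) _); rewrite !mnmE /=.
  by have := ltn_ord p; lia.
split=> // m; have [sm|ms] := leqP (size (rcons mu r)) m; first exact: fin.
apply: leq_trans (psum_le m xl); apply: leq_trans (xp m).
by rewrite size_rcons ltnS in ms; rewrite -cats1 takel_cat.
Qed.

End Vandermonde.

(** * Power sums and colorings *)

Section Colorings.

Variables (F : fieldType) (n k : nat).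
Implicit Types (s t u : 'S_n) (f : {ffun 'I_n -> 'I_k}).

Definition content f : 'X_{1..k} := [multinom #|[set x | f x == i]| | i < k].

Definition color_sum s : {mpoly F[k]} :=
  \sum_(f : {ffun 'I_n -> 'I_k} | [forall x, f (s x) == f x]) 'X_[content f].

Lemma prod_color f : \prod_x 'X_(f x) = 'X_[content f] :> {mpoly F[k]}.
Proof.
rewrite mprodXE; congr 'X_[_]; apply/mnmP => i; rewrite mnm_sumE mnmE.
rewrite -sum1dep_card [RHS]big_mkcond /=; apply: eq_bigr => x _.
by rewrite mnm1E; case: eqP.
Qed.

Lemma color_sumJ s u : color_sum (s ^ u)%g = color_sum s.
Proof.
pose h (v : 'S_n) (f : {ffun 'I_n -> 'I_k}) : {ffun 'I_n -> 'I_k} :=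
  [ffun x => f (v x)].
have hK (v : 'S_n) : cancel (h v) (h v^-1%g).
  by move=> f; apply/ffunP => x; rewrite !ffunE permKV.
have hKV (v : 'S_n) : cancel (h v^-1%g) (h v).
  by move=> f; apply/ffunP => x; rewrite !ffunE permK.
rewrite /color_sum [RHS](reindex (h u)) /=;
  last by exists (h u^-1%g) => f _; rewrite ?hK ?hKV.
apply: eq_big => [f|f _].
  apply/forallP/forallP => H x; rewrite ?ffunE.
    by have := H (u x); rewrite permJ.
  by have := H (u^-1%g x); rewrite !ffunE permKV -permJ permKV.
congr 'X_[_]; apply/mnmP => i; rewrite !mnmE.
rewrite -[RHS](card_imset _ (@perm_inj _ u)); apply: eq_card => x.
rewrite inE; apply/idP/imsetP => [fx|[y]]; last by rewrite inE ffunE => ? ->.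
by exists (u^-1%g x); rewrite ?inE ?ffunE permKV.
Qed.

(** Distribute the product: choosing one term in each power sum is choosing a color for each cycle,
    which is a coloring fixed by s. *)
Lemma color_sum_porbits s :
  color_sum s = \prod_(X in porbits s) power_sum F k #|X|.
Proof.
pose I := {X in porbits s}.
pose orb x : I := exist _ (porbit s x) (imset_f (porbit s) (erefl true)).
have [pt ptP] : exists pt : I -> 'I_n, forall X : I, porbit s (pt X) = val X.
  apply: fin_all_exists (fun X x => porbit s x = val X) _ => X.
  by have /imsetP[x _ ->] := valP X; exists x.
have ptK X : orb (pt X) = X by apply: val_inj; rewrite /= ptP.
transitivity (\prod_(X : I) power_sum F k #|val X|); last first.
  exact/esym/big_sub.
rewrite /power_sum bigA_distr_bigA /=.
pose h (g : {ffun I -> 'I_k}) : {ffun 'I_n -> 'I_k} := [ffun x => g (orb x)].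
pose h' (f : {ffun 'I_n -> 'I_k}) : {ffun I -> 'I_k} := [ffun X => f (pt X)].
have inv f x y : [forall x, f (s x) == f x] -> porbit s x = porbit s y -> f x = f y.
  move=> /forallP fs /eqP; rewrite eq_porbit_mem => /porbitP[i ->].
  elim: i => [|i <-]; first by rewrite perm1.
  by rewrite expgSr permM; apply/eqP.
rewrite /color_sum (reindex_onto h h') /=; last first.
  move=> f fs; apply/ffunP => x; rewrite !ffunE; apply: inv fs _; exact: ptP.
apply: eq_big => [g|g _].
  apply/andP; split; last by apply/eqP/ffunP => X; rewrite !ffunE ptK.
  apply/forallP => x; rewrite !ffunE; apply/eqP; congr (g _); apply: val_inj => /=.
  by have := porbit_perm s 1 x; rewrite expg1.
rewrite -prod_color (partition_big orb xpredT) //=; apply: eq_bigr => X _.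
rewrite (eq_bigr (fun=> 'X_(g X))) => [|x /eqP <-]; last by rewrite ffunE.
rewrite prodr_const; congr (_ ^+ _); apply: eq_card => x; rewrite unfold_in /=.
by rewrite (mem_porbits_eq _ (valP X)).
Qed.

Lemma prod_power_sums s (j : intpart n) : s \in conj_class j ->
  \prod_(1 <= q < n.+1) power_sum F k q ^+ npart j q = color_sum s.
Proof.
move=> /conj_classP sj; rewrite color_sum_porbits.
have lt (X : {set 'I_n}) : (#|X| < n.+1)%N
  by rewrite ltnS -[leqRHS]card_ord max_card.
rewrite (partition_big (fun X : {set 'I_n} => Ordinal (lt X)) xpredT) //=.
rewrite big_ord_recl.
(* No cycle is empty, so size 0 contributes the factor 1 and the product may start at 1. *)
rewrite [X in _ = X * _]big_pred0 => [|X]; last first.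
  apply/negP => /andP[/imsetP[x _ ->] /eqP/(congr1 val)/eqP /=].
  by rewrite (negPf (card_porbit_neq0 _ _)).
rewrite mul1r big_add1 /= big_mkord; apply: eq_bigr => q _; rewrite -sj //.
rewrite -prodr_const; apply: eq_big => [X|X];
  first by rewrite inE -(inj_eq val_inj).
by rewrite inE => /andP[_ /eqP ->].
Qed.

(** Replaces the sum over partitions by a sum over the group: both [chi] and [color_sum] are
    constant on the set of permutations of a given cycle type. *)
Lemma frobenius_sum (C : intpart n -> 'S_n) (chi : 'S_n -> F) (D : {mpoly F[k]}) :
    (forall j, C j \in conj_class j) -> (forall s u, chi (s ^ u)%g = chi s) ->
  \sum_(j : intpart n) (#|conj_class j|%:R * chi (C j)) *:
     (D * \prod_(1 <= q < n.+1) power_sum F k q ^+ npart j q)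
  = \sum_s chi s *: (D * color_sum s).
Proof.
move=> CP chiJ.
have [ty tyP] := cycle_type_fun n.
rewrite [RHS](partition_big ty xpredT) //=; apply: eq_bigr => j _.
rewrite (prod_power_sums (CP j)).
rewrite (eq_bigr (fun=> chi (C j) *: (D * color_sum (C j)))).
  rewrite sumr_const -scaler_nat scalerA; congr (_%:R * _ *: _).
  apply: eq_card => s; transitivity (ty s == j) => //.
  apply/idP/eqP => [sj|<-] //.
  exact: cycle_type_unique sj.
move=> s /eqP e; have sj : s \in conj_class j by rewrite -e.
by have [u ->] := conj_class_conj sj (CP j); rewrite chiJ color_sumJ.
Qed.

End Colorings.

(** * Counting colorings by their orbits under Young subgroups *)

Section Orbits.

Variables (n k : nat).
Implicit Types (f : {ffun 'I_n -> 'I_k}) (p q u : 'S_n).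

Definition fixes f p := [forall x, f (p x) == f x].

(** Here O is the orbit of [f0]. The group elements p with f0 o p = f form a translate of the
    stabilizer of f, so the stabilizers over one orbit add up to the group. *)
Lemma sum_card_fixes (r : 'I_n -> nat) f0 (O : pred {ffun 'I_n -> 'I_k}) :
    (forall f, O f -> exists2 a, a \in stab r & forall x, f x = f0 (a x)) ->
    (forall p, p \in stab r -> O [ffun x => f0 (p x)]) ->
  (\sum_(f | O f) #|[set p in stab r | fixes f p]| = #|stab r|)%N.
Proof.
move=> Oa aO; rewrite -sum1_card.
rewrite [RHS](partition_big (fun p => [ffun x => f0 (p x)]) O) //=.
apply: eq_bigr => f /Oa[a ar fa]; rewrite -sum1dep_card.
rewrite [RHS](reindex_inj (mulIg a)) /=; apply: eq_bigl => p.
rewrite stabMr //; congr andb; apply/forallP/eqP => [H|/ffunP H x].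
  by apply/ffunP => x; rewrite ffunE permM -fa; apply/eqP.
by have := H x; rewrite ffunE permM -fa => ->.
Qed.

Lemma content_psum f m : psum (content f) m = #|[set x | (f x < m)%N]|.
Proof.
rewrite -sum1_card (partition_big f (fun i : 'I_k => (i < m)%N)) /=;
  last by move=> x; rewrite inE.
apply: eq_bigr => i im; rewrite mnmE -sum1_card; apply: eq_bigl => x.
by rewrite !inE; case: eqP => [->|]; rewrite ?im ?andbF.
Qed.

Lemma content_comp f (p : 'S_n) : content [ffun x => f (p x)] = content f.
Proof.
apply/mnmP => i; rewrite !mnmE -[RHS](card_imset _ (@perm_inj _ (p^-1)%g)).
apply: eq_card => x; rewrite inE ffunE; apply/idP/imsetP => [fx|[y]].
  by exists (p x); rewrite ?inE // permK.
by rewrite inE => ? ->; rewrite permKV.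
Qed.

Lemma content_eq_comp f g : content f = content g ->
  exists p : 'S_n, forall x, f x = g (p x).
Proof.
by move=> /mnmP e; apply: eq_fibers_perm => i; have := e i; rewrite !mnmE.
Qed.

(** Orbit counting for the whole symmetric group, obtained with a constant r; stabilizers of
    colorings with equal content are conjugate. *)
Lemma card_content f0 :
  (#|[pred f : {ffun 'I_n -> 'I_k} | content f == content f0]|
     * #|stab (fun x => f0 x : nat)| = n`!)%N.
Proof.
rewrite -card_Sn; have <- : #|stab (fun _ : 'I_n => 0%N)| = #|{: 'S_n}|.
  by apply: eq_card => p; apply/stabP.
rewrite -(@sum_card_fixes (fun=> 0%N) f0
  [pred f : {ffun 'I_n -> 'I_k} | content f == content f0]) /=; first last.
- by move=> p _; rewrite content_comp.
- by move=> f /eqP /content_eq_comp[p fp]; exists p => //; apply/stabP.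
rewrite -sum_nat_const; apply: eq_bigr => f /eqP /content_eq_comp[a fa].
rewrite -[RHS](card_imset _ (conjg_inj a)); apply: eq_card => q.
apply/stabP/imsetP => [qs|[p + ->] x]; last first.
  rewrite !inE => /andP[_ /forallP fp].
  rewrite -(permKV a x) permJ -!fa; exact/congr1/eqP/fp.
exists (q ^ a^-1)%g; last by rewrite conjgKV.
rewrite inE; apply/andP; split; first exact/stabP.
apply/forallP => x; rewrite !fa -{1}(permK a x) permJ permKV.
by apply/eqP/val_inj/qs.
Qed.

End Orbits.

Section Burnside.

Variables (F : fieldType) (n k : nat) (r : 'I_n -> nat) (mu : seq nat).
Hypotheses (r_lt : forall x, (r x < size mu)%N)
           (r_card : forall j : nat, #|[set x | r x == j]| = nth 0%N mu j).

(** A common degree bound gives all factors of [hprod] the same index type, so that their product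
    can be distributed. *)
Lemma hsym_bounded b q : (q <= b)%N ->
  hsym F k q = \sum_(m : 'X_{1..k < b.+1} | mdeg m == q) 'X_[m].
Proof.
by move=> qb; apply/mpolyP => m; rewrite mcoeff_hsym mcoeff_sum_mdeg.
Qed.

Lemma mu_le j : (nth 0%N mu j <= n)%N.
Proof. by rewrite -r_card -[leqRHS]card_ord max_card. Qed.

(** The content of f on block j. The family of these is a complete invariant of the orbit of f under
    [stab r]: see [T_eq] and [T_onto]. *)
Let joint (f : {ffun 'I_n -> 'I_k}) (j : 'I_(size mu)) : 'X_{1..k} :=
  [multinom #|[set x | (r x == j) && (f x == i)]| | i < k].

Let mdeg_joint f j : mdeg (joint f j) = nth 0%N mu j.
Proof.
rewrite -r_card mdegE -sum1_card (partition_big f xpredT) //=.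
by apply: eq_bigr => i _; rewrite mnmE -sum1_card; apply: eq_bigl => x;
  rewrite !inE.
Qed.

Let joint_lt f j : (mdeg (joint f j) < n.+1)%N.
Proof. by rewrite mdeg_joint ltnS mu_le. Qed.

Let T f : {ffun 'I_(size mu) -> 'X_{1..k < n.+1}} :=
  [ffun j => BMultinom (joint_lt f j)].

Let content_joint f : content f = (\sum_j joint f j)%MM.
Proof.
apply/mnmP => i; rewrite mnmE mnm_sumE -sum1_card.
rewrite (partition_big (fun x => Ordinal (r_lt x)) xpredT) //=.
apply: eq_bigr => j _; rewrite mnmE -sum1_card; apply: eq_bigl => x.
by rewrite !inE andbC -(inj_eq val_inj).
Qed.

Let T_eq (f g : 'I_n -> 'I_k) :
  (forall (j : nat) (i : 'I_k), #|[set x | (r x == j) && (f x == i)]|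
     = #|[set x | (r x == j) && (g x == i)]|) ->
  exists2 a, a \in stab r & forall x, f x = g (a x).
Proof.
move=> e.
have [|a aE] := @eq_fibers_perm n (nat * 'I_k)%type
  (fun x => (r x, f x)) (fun x => (r x, g x)).
  move=> [j i]; have E (h : 'I_n -> 'I_k) : #|[set x | (r x, h x) == (j, i)]|
      = #|[set x | (r x == j) && (h x == i)]|.
    by apply: eq_card => x; rewrite !inE xpair_eqE.
  exact: etrans (E f) (etrans (e j i) (esym (E g))).
by exists a => [|x]; [apply/stabP => x|]; have [] := aE x.
Qed.

Let T_onto (M : {ffun 'I_(size mu) -> 'X_{1..k < n.+1}}) :
  (forall j, mdeg (M j) = nth 0%N mu j) -> exists f, T f = M.
Proof.
move=> Md; have [|g gE] := @fibers_exist n _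
  (fun u : 'I_(size mu) * 'I_k => (M u.1 : 'X_{1..k}) u.2).
  rewrite -(pair_bigA _ (fun j i => (M j : 'X_{1..k}) i)) /=.
  under eq_bigr => j _ do rewrite -mdegE Md -r_card.
  rewrite -[RHS]card_ord -sum1_card.
  rewrite (partition_big (fun x => Ordinal (r_lt x)) xpredT) //=.
  by apply: eq_bigr => j _; rewrite -sum1_card; apply: eq_bigl => x;
    rewrite !inE -(inj_eq val_inj).
(* The map g has the right number of points for each block and color, but its blocks need not be
   those of r; the permutation a aligns them. *)
have [|a aE] := @eq_fibers_perm n _ (fun x => Ordinal (r_lt x)) (fun x => (g x).1).
  move=> j; transitivity (\sum_i #|[set x | g x == (j, i)]|)%N.
    under eq_bigr do rewrite gE /=.
    rewrite -mdegE Md -r_card; apply: eq_card => x;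
      by rewrite !inE -(inj_eq val_inj).
  rewrite -[RHS]sum1_card (partition_big (fun x => (g x).2) xpredT) //=.
  apply: eq_bigr => i _; rewrite -sum1_card; apply: eq_bigl => x.
  by rewrite !inE; case: (g x) => j' i'; rewrite xpair_eqE.
exists [ffun x => (g (a x)).2]; apply/ffunP => j; apply: val_inj; apply/mnmP => i.
rewrite ffunE /= mnmE -(gE (j, i)) -[LHS](card_imset _ (@perm_inj _ a)).
have E y : (r y == j) = ((g (a y)).1 == j).
  by have /= <- := aE y; rewrite -(inj_eq val_inj).
apply: eq_card => x; rewrite inE; apply/imsetP/idP => [[y]|].
  by rewrite inE ffunE E => /andP[/eqP <- /eqP <-] ->; case: (g _) => ? ?.
move=> /eqP gx; exists (a^-1%g x); last by rewrite permKV.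
by rewrite inE ffunE E permKV gx !eqxx.
Qed.

(** After exchanging the sums each coloring is weighted by its stabilizer in [stab r], so every
    orbit has weight [#|stab r|]. The orbits correspond to choices of one monomial of degree mu_j
    for each j, which are the terms of [hprod]. *)
Lemma burnside_hprod :
  \sum_(p in stab r) color_sum F k p = #|stab r|%:R *: hprod F k mu.
Proof.
have -> : hprod F k mu = \sum_(M : {ffun 'I_(size mu) -> 'X_{1..k < n.+1}} |
    [forall j, mdeg (M j) == nth 0%N mu j]) 'X_[(\sum_j M j)%MM].
  rewrite /hprod (big_nth 0%N) big_mkord.
  under eq_bigr => j _ do rewrite (hsym_bounded (mu_le j)).
  rewrite bigA_distr_big_dep.
  apply: eq_big => [M|M _]; last by rewrite mprodXE.
  by apply/familyP/forallP.
transitivity (\sum_(f : {ffun 'I_n -> 'I_k}) #|[set p in stab r | fixes f p]|%:R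
  *: 'X_[F, content f]).
  rewrite /color_sum; under eq_bigr do rewrite big_mkcond.
  rewrite exchange_big; apply: eq_bigr => f _ /=.
  rewrite -big_mkcondr /= sumr_const scaler_nat; congr (_ *+ _).
  by apply: eq_card => p; rewrite inE.
rewrite scaler_sumr (partition_big T
  (fun M => [forall j : 'I_(size mu), mdeg (M j) == nth 0%N mu j])) /=; last first.
  by move=> f _; apply/forallP => j; rewrite ffunE /= mdeg_joint.
apply: eq_bigr => M /forallP MP; have [|f0 f0M] := T_onto (M := M).
  by move=> j; apply/eqP.
rewrite (eq_bigr (fun f =>
  #|[set p in stab r | fixes f p]|%:R *: 'X_[(\sum_j M j)%MM])).
  rewrite -scaler_suml -natr_sum (@sum_card_fixes _ _ r f0) //.
    move=> f /eqP fM; apply: T_eq => j i; have [jN|Nj] := ltnP j (size mu).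
      have /(congr1 (fun M : {ffun _} => M (Ordinal jN))) : T f = T f0
        by rewrite fM.
      by rewrite !ffunE => /(congr1 val)/mnmP/(_ i); rewrite !mnmE.
    by rewrite !eq_card0 // => x; rewrite inE (ltn_eqF (leq_trans (r_lt x) Nj)).
  move=> p /stabP pr; rewrite -f0M; apply/eqP/ffunP => j; rewrite !ffunE.
  apply: val_inj; apply/mnmP => i; rewrite !mnmE.
  rewrite -[LHS](card_imset _ (@perm_inj _ p)).
  apply: eq_card => x; rewrite inE; apply/imsetP/idP => [[y]|fx].
    by rewrite inE ffunE => ? ->; rewrite pr.
  by exists (p^-1%g x); rewrite ?permKV // inE ffunE -pr permKV.
move=> f /eqP <-; rewrite content_joint; congr (_ *: 'X_[_]).
by apply: eq_bigr => j _; rewrite ffunE.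
Qed.

End Burnside.

(** * The Frobenius formula *)

(** For square matrices A B = 1 implies B A = 1. *)
Lemma dual_family (F : fieldType) (T : finType) (a b : T -> T -> F) :
    (forall x y, \sum_j a x j * b j y = (x == y)%:R) ->
  forall j j', \sum_x b j x * a x j' = (j == j')%:R.
Proof.
move=> ab j j'.
pose A := \matrix_(i < #|T|, l < #|T|) a (enum_val i) (enum_val l).
pose B := \matrix_(i < #|T|, l < #|T|) b (enum_val i) (enum_val l).
have /mulmx1C BA : A *m B = 1%:M.
  apply/matrixP => i l; rewrite !mxE -(inj_eq enum_val_inj) -ab.
  rewrite [RHS](reindex (enum_val : 'I_#|T| -> T)) /=;
    last by exists enum_rank => i' _; rewrite ?enum_valK ?enum_rankK.
  by apply: eq_bigr => p _; rewrite !mxE.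
have /matrixP/(_ (enum_rank j) (enum_rank j')) := BA.
rewrite !mxE (inj_eq enum_rank_inj) => <-.
rewrite [LHS](reindex (enum_val : 'I_#|T| -> T)) /=;
  last by exists enum_rank => i' _; rewrite ?enum_valK ?enum_rankK.
by apply: eq_bigr => p _; rewrite !mxE !enum_rankK.
Qed.

Section Functional.

Variables (F : fieldType) (n k : nat).
Hypothesis charF0 : [pchar F] =i pred0.

Local Notation R := (regular_repr F [set: 'S_n]).
Local Notation bch A := (fun g => bform A (R g)).

(* X_lambda(chi) for l = lambda + rho. *)
Definition alt_coef (l : 'X_{1..k}) (chi : 'S_n -> F) : F :=
  (n`!)%:R^-1 * \sum_s chi s * (vandermonde_prod F k * color_sum F k s)@_l.

Lemma alt_coef_sum (I : finType) (c : I -> F) (chi : I -> 'S_n -> F) l psi :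
  (forall s, psi s = \sum_i c i * chi i s) ->
  alt_coef l psi = \sum_i c i * alt_coef l (chi i).
Proof.
move=> E; rewrite /alt_coef; under [RHS]eq_bigr do rewrite mulrCA.
rewrite -mulr_sumr; congr (_ * _); under [RHS]eq_bigr do rewrite mulr_sumr.
rewrite [RHS]exchange_big; apply: eq_bigr => s _ /=; rewrite E mulr_suml.
by apply: eq_bigr => i _; rewrite mulrA.
Qed.

Lemma alt_coefZ c chi l : alt_coef l (fun s => c * chi s) = c * alt_coef l chi.
Proof.
rewrite /alt_coef mulrCA; congr (_ * _); rewrite mulr_sumr.
by apply: eq_bigr => s _; rewrite mulrA.
Qed.

Lemma bformJ A g u : bform A (R (g ^ u)%g) = bform A (R g).
Proof.
by rewrite conjgE mulgA rhoM bform_cyc -rhoM mulgA mulgV mul1g.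
Qed.

(** Exchange the sums over permutations and fixed colorings: the permutations fixing f add up to the
    sum over its Young subgroup. *)
Lemma alt_coef_bform l A :
  alt_coef l (bch A) = (n`!)%:R^-1 *
    \sum_(f : {ffun 'I_n -> 'I_k})
       (vandermonde_prod F k * 'X_[content f])@_l
       * bform A (rsum R (fun x => f x : nat)).
Proof.
congr (_ * _); transitivity (\sum_s \sum_(f : {ffun 'I_n -> 'I_k} | fixes f s)
    (vandermonde_prod F k * 'X_[content f])@_l * bform A (R s)).
  apply: eq_bigr => s _; rewrite /color_sum mulr_sumr raddf_sum mulr_sumr /=.
  by apply: eq_bigr => f _; rewrite mulrC.
rewrite (exchange_big_dep xpredT) //=; apply: eq_bigr => f _; rewrite -mulr_sumr;
  congr (_ * _).
have -> : rsum R (fun x => f x : nat)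
    = \sum_(s in stab (fun x => f x : nat)) 1 *: R s.
  by apply: eq_bigr => s _; rewrite scale1r.
rewrite bform_sumr; apply: eq_big => s; last by rewrite mul1r.
by rewrite inE.
Qed.

Lemma mcoeff_vandermondeX (f : {ffun 'I_n -> 'I_k}) (l : 'X_{1..k}) :
    (vandermonde_prod F k * 'X_[content f])@_l != 0 ->
  exists w, l = (perm_mnm w + content f)%MM.
Proof.
rewrite -mcoeff_msupp (perm_mem (msuppMX _ _)) => /mapP[m].
rewrite mcoeff_msupp => nz ->; have [w e] := vandermonde_neq0E nz.
by exists w; rewrite -e addmC.
Qed.

Section OneShape.

Variables (row col : 'I_n -> nat).
Hypothesis rc_inj : forall x y, row x = row y -> col x = col y -> x = y.
Hypothesis rc_closed :
  forall x i, (i <= row x)%N -> exists2 y, row y = i & col y = col x.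

Local Notation c := (young R row col).

Lemma alt_coef_young_dom l : alt_coef l (bch c) != 0 ->
  forall m, (psum l m <= psum (rho_mnm k) m + #|[set x | (row x < m)%N]|)%N.
Proof.
rewrite alt_coef_bform mulf_eq0 negb_or => /andP[_ nz] m.
have [f] : exists f : {ffun 'I_n -> 'I_k},
    (vandermonde_prod F k * 'X_[content f])@_l
    * bform c (rsum R (fun x => f x : nat)) != 0.
  apply/existsP; apply: contraNT nz => /existsPn N; rewrite big1 // => f _.
  by apply/eqP; have := N f; rewrite negbK.
rewrite mulf_eq0 negb_or => /andP[/mcoeff_vandermondeX[w ->]].
move=> /(bform_young_rsum_dom charF0 rc_closed) dom.
by rewrite psumD leq_add ?psum_perm_mnm // content_psum.
Qed.

(** A contributing coloring meets two opposite dominance bounds, so its content is that of [f0].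
    There are n! / [#|stab row|] such colorings, and each contributes [hook] times [#|stab row|]. *)
Lemma alt_coef_young_eq (f0 : {ffun 'I_n -> 'I_k}) :
    (forall x, f0 x = row x :> nat) ->
  alt_coef (rho_mnm k + content f0)%MM (bch c) = hook F row col.
Proof.
move=> f0E; rewrite alt_coef_bform.
pose same := [pred f : {ffun 'I_n -> 'I_k} | content f == content f0].
rewrite (bigID same) /= addrC big1 ?add0r; last first.
  move=> f ff0; apply/eqP; apply: contraNT ff0; rewrite mulf_eq0 negb_or.
  move=> /andP[/mcoeff_vandermondeX[w lE]].
  move=> /(bform_young_rsum_dom charF0 rc_closed) dom.
  apply/eqP/psum_inj => m; apply/eqP; rewrite eqn_leq; apply/andP; split.
    rewrite !content_psum (leq_trans (dom m)) //;
      apply/subset_leq_card/subsetP => x.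
    by rewrite !inE f0E.
  rewrite -(leq_add2l (psum (rho_mnm k) m)) -psumD lE psumD leq_add2r.
  exact: psum_perm_mnm.
rewrite (eq_bigr (fun=> hook F row col * #|stab row|%:R)).
  rewrite sumr_const -[X in _ * X]mulr_natr -(mulrA (hook F row col)) -natrM
    mulnC mulrCA.
  have -> : #|stab row| = #|stab (fun x => f0 x : nat)|.
    by apply: eq_card => p; rewrite !inE; apply: eq_forallb => x; rewrite !f0E.
  by rewrite card_content mulVf ?mulr1 // natF_neq0 // fact_gt0.
move=> f /eqP ff; have [a aE] := content_eq_comp ff.
rewrite -ff addmC mcoeffMX mcoeff_vandermonde_rho mul1r -bform_young_rsum //.
(* As f = f0 o a, its Young subgroup is conjugate to the row stabilizer, and the form does not see
   the conjugation. *)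
have E g : rsum R g = \sum_(s in stab g) 1 *: R s.
  by apply: eq_bigr => s _; rewrite scale1r.
rewrite !E !bform_sumr; rewrite [RHS](reindex_inj (conjg_inj a)) /=.
apply: eq_big => s; last by rewrite bformJ.
apply/stabP/stabP => H x.
  rewrite -(permKV a x) permJ -!f0E -!aE; exact: H.
by have := H (a x); rewrite permJ -!f0E -!aE.
Qed.

End OneShape.

(** Up to a nonzero factor this class function is the permutation character of a Young subgroup. Its
    characteristic is a multiple of [hprod], to which [hprod_dom] applies. *)
Lemma alt_coef_rsum_dom (r : 'I_n -> nat) (mu : seq nat) l :
    (forall x, (r x < size mu)%N) ->
    (forall j : nat, #|[set x | r x == j]| = nth 0%N mu j) -> sdecr l ->
    alt_coef l (bch (rsum R r)) != 0 ->
  forall m, (psum (rho_mnm k) m + sumn (take m mu) <= psum l m)%N.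
Proof.
move=> r_lt r_card ld nz; apply: (@hprod_dom F) => //; first exact: char2.
apply: contraNneq nz => z; rewrite /alt_coef.
rewrite (_ : \sum_s _ = 0) ?mulr0 //.
transitivity ((vandermonde_prod F k
  * \sum_s bform (rsum R r) (R s) *: color_sum F k s)@_l).
  rewrite mulr_sumr raddf_sum /=; apply: eq_bigr => s _.
  by rewrite -scalerAr mcoeffZ.
suff -> : \sum_s bform (rsum R r) (R s) *: color_sum F k s
    = (n`! * #|stab r|)%:R *: hprod F k mu by rewrite -scalerAr mcoeffZ z mulr0.
(* The equation p u s = u has the single solution s = u^-1 p^-1 u. *)
transitivity (\sum_(p in stab r) \sum_(u : 'S_n) color_sum F k (p^-1 ^ u)%g).
  transitivity (\sum_s \sum_(p in stab r) \sum_(u : 'S_n)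
    ((p * u * s)%g == u)%:R *: color_sum F k s).
    apply: eq_bigr => s _.
    have -> : rsum R r = \sum_(p in stab r) 1 *: R p.
      by apply: eq_bigr => p _; rewrite scale1r.
    rewrite bform_suml scaler_suml; apply: eq_bigr => p _.
    by rewrite mul1r bform_group scaler_suml.
  rewrite exchange_big; apply: eq_bigr => p _ /=.
  rewrite exchange_big; apply: eq_bigr => u _ /=.
  rewrite (bigD1 (p^-1 ^ u)%g) //= big1 ?addr0 => [|s su].
    by rewrite conjgE !mulgA mulgK mulgV mul1g eqxx scale1r.
  rewrite (_ : _ == u = false) ?scale0r //; apply: contraNF su => /eqP e.
  by apply/eqP/(mulgI (p * u)%g); rewrite e conjgE !mulgA mulgK mulgV mul1g.
under eq_bigr do under eq_bigr do rewrite color_sumJ.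
under eq_bigr do rewrite sumr_const card_Sn.
rewrite sumrMnl (reindex_inj invg_inj) /=.
have -> : \sum_(p | p^-1%g \in stab r) color_sum F k p^-1^-1%g =
  #|stab r|%:R *: hprod F k mu.
  rewrite -burnside_hprod //; apply: eq_big => p; first by rewrite stabV.
  by rewrite invgK.
by rewrite -scaler_nat scalerA natrM.
Qed.

End Functional.

Lemma eq_sumn_take_nth s t : (forall m, sumn (take m s) = sumn (take m t)) ->
  forall i, nth 0%N s i = nth 0%N t i.
Proof.
move=> e i; have := e i.+1; rewrite !sumn_take_nth !big_ord_recr /=
  -!sumn_take_nth e.
by move/addnI.
Qed.

(** * Expansion of class functions along the Young symmetrizers *)

Section Expansion.

Variables (F : fieldType) (n : nat).
Hypothesis charF0 : [pchar F] =i pred0.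
Variable C : intpart n -> 'S_n.
Hypothesis C_type : forall j, C j \in conj_class j.

Local Notation R := (regular_repr F [set: 'S_n]).

Definition parts (j : intpart n) : seq nat := map val (val j).

Lemma parts_sorted j : sorted geq (parts j).
Proof. by have /andP[] := valP j. Qed.

Lemma parts_sum j : sumn (parts j) = n.
Proof. by have /andP[_ /eqP] := valP j. Qed.

Lemma parts_inj i j :
  (forall m, sumn (take m (parts i)) = sumn (take m (parts j))) -> i = j.
Proof.
move=> e; apply: val_inj; apply: val_inj; apply: (inj_map val_inj).
apply: (@eq_from_nth _ 0%N) => [|m _]; first by rewrite !size_map !size_tuple.
exact: eq_sumn_take_nth.
Qed.

Local Notation row j := (@rowf n (parts j)).
Local Notation col j := (@colf n (parts j)).
Local Notation c j := (young R (row j) (col j)).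
Local Notation h j := (hook F (row j) (col j)).
Local Notation cf j := (young_coef F (row j) (col j)).

Let rcI j := @row_col_inj n (parts j).
Let rcC j := @row_col_closed n (parts j) (parts_sorted j) (parts_sum j).

Definition young_mult j (chi : 'S_n -> F) : F := (h j)^-1 * \sum_g cf j g * chi g.
Definition young_char j (g : 'S_n) : F := (h j)^-1 * bform (c j) (R g).

Let hN0 j : h j != 0. Proof. exact: (hook_neq0 charF0 (@rcI j) (rcC (j := j))). Qed.

Lemma young_mult_bform j A :
  young_mult j (fun g => bform A (R g)) = (h j)^-1 * bform A (c j).
Proof. by rewrite /young_mult young_gr /gr bform_sumr. Qed.

Lemma bform_young_sym i j : bform (c i) (c j) = bform (c j) (c i).
Proof. by rewrite !young_gr bform_sym. Qed.

Lemma bform_young_parts_dom i j : bform (c i) (c j) != 0 ->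
  forall m, (sumn (take m (parts j)) <= sumn (take m (parts i)))%N.
Proof.
move=> /(bform_young_young_dom charF0 (rcC (j := i))) dom m.
by have := dom m; rewrite !card_row_lt ?parts_sum.
Qed.

(** The diagonal value is h^2 / (h h). Off the diagonal a nonzero value would, by symmetry of the
    form, make each partition dominate the other. *)
Lemma young_mult_char i j : young_mult i (young_char j) = (i == j)%:R.
Proof.
have -> : young_mult i (young_char j)
    = (h j)^-1 * young_mult i (fun g => bform (c j) (R g)).
  rewrite /young_mult mulrCA; congr (_ * _); rewrite mulr_sumr.
  by apply: eq_bigr => g _; rewrite /young_char mulrCA.
rewrite young_mult_bform; have [<-|ij] := eqVneq i j.
  rewrite (bform_young_young charF0 (@rcI i) (rcC (j := i))) expr2 !mulrA.
  by rewrite -(mulrA (h i)^-1) mulVf // mulr1 mulVf.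
rewrite (_ : bform _ _ = 0) ?mulr0 //; apply/eqP; apply: contraNT ij => nz.
apply/eqP/parts_inj => m; apply/eqP; rewrite eqn_leq bform_young_parts_dom //.
by rewrite bform_young_parts_dom // bform_young_sym.
Qed.

(** A class function is given by its values at the [C j]. In these coordinates the functionals and
    the characters are square families indexed by partitions, so duality on one side gives it on the
    other. *)
Lemma class_fun_expansion (chi : 'S_n -> F) : (forall s u, chi (s ^ u)%g = chi s) ->
  forall g, chi g = \sum_j young_mult j chi * young_char j g.
Proof.
move=> chiJ g; have [ty tyP] := cycle_type_fun n.
have cC (phi : 'S_n -> F) s : (forall s u, phi (s ^ u)%g = phi s) ->
  phi s = phi (C (ty s)).
  by move=> phiJ; have [u ->] := conj_class_conj (tyP s) (C_type (ty s));
    rewrite phiJ.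
have sJ j s u : young_char j (s ^ u)%g = young_char j s
  by rewrite /young_char bformJ.
pose b (j l : intpart n) := (h l)^-1 * \sum_(g | ty g == j) cf l g.
have mE l (phi : 'S_n -> F) : (forall s u, phi (s ^ u)%g = phi s) ->
    young_mult l phi = \sum_j phi (C j) * b j l.
  move=> phiJ; rewrite /young_mult (partition_big ty xpredT) //= mulr_sumr.
  apply: eq_bigr => j _; rewrite /b [RHS]mulrCA; congr (_ * _); rewrite mulr_sumr.
  by apply: eq_bigr => s /eqP <-; rewrite -cC // mulrC.
have D j j' : \sum_l b j l * young_char l (C j') = (j == j')%:R.
  apply: (@dual_family _ _ (fun l j => young_char l (C j)) b) => x y.
  by rewrite -mE // young_mult_char eq_sym.
rewrite [LHS]cC //; transitivity (\sum_j chi (C j) * (j == ty g)%:R).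
  rewrite (bigD1 (ty g)) //= eqxx mulr1 big1 ?addr0 // => j /negPf->.
  by rewrite mulr0.
rewrite (eq_bigr (fun j => \sum_l chi (C j) * b j l * young_char l (C (ty g)))).
  rewrite exchange_big; apply: eq_bigr => l _ /=.
  by rewrite -mulr_suml -mE // -cC.
by move=> j _; rewrite -D mulr_sumr; apply: eq_bigr => l _; rewrite mulrA.
Qed.

End Expansion.

Section Frobenius.

Variables (F : fieldType) (n k : nat).
Hypothesis charF0 : [pchar F] =i pred0.
Variable C : intpart n -> 'S_n.
Hypothesis C_type : forall j, C j \in conj_class j.
Variable lam : k.-tuple nat.
Hypotheses (lam_sorted : sorted geq lam) (lam_sum : sumn lam = n).

Local Notation R := (regular_repr F [set: 'S_n]).
Local Notation row j := (@rowf n (parts j)).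
Local Notation col j := (@colf n (parts j)).
Local Notation c j := (young R (row j) (col j)).
Local Notation h j := (hook F (row j) (col j)).
Local Notation l := (frobenius_exp lam).

Let rcI (j : intpart n) := @row_col_inj n (parts j).
Let rcC (j : intpart n) := @row_col_closed n (parts j) (parts_sorted j)
  (parts_sum j).
Let hN0 (j : intpart n) : h j != 0.
Proof. exact: (hook_neq0 charF0 (@rcI j) (rcC (j := j))). Qed.

Lemma rowf_lam_lt (x : 'I_n) : (rowf lam x < k)%N.
Proof. by rewrite -[X in (_ < X)%N](size_tuple lam) reshape_indexP ?lam_sum. Qed.

Definition lam_coloring : {ffun 'I_n -> 'I_k} :=
  [ffun x => Ordinal (rowf_lam_lt x)].

Lemma frobenius_expE : l = (rho_mnm k + content lam_coloring)%MM.
Proof.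
apply/mnmP => i; rewrite mnmE mnmDE !mnmE addnC; congr (_ + _)%N.
rewrite (tnth_nth 0%N) -(card_row_eq lam_sum); apply: eq_card => x.
by rewrite !inE ffunE -(inj_eq val_inj).
Qed.

Lemma psum_frobenius_exp m : psum l m = (psum (rho_mnm k) m + sumn (take m lam))%N.
Proof.
rewrite frobenius_expE psumD content_psum -(card_row_lt lam_sum); congr (_ + _)%N.
by apply: eq_card => x; rewrite !inE ffunE.
Qed.

Lemma frobenius_exp_sdecr : sdecr l.
Proof.
move=> i j ij; rewrite !mnmE !(tnth_nth 0%N).
have := sorted_geq_nth lam_sorted (ltnW ij).
have := ltn_ord j; have := ltn_ord i; move: ij => ij ik jk le.
rewrite -addnS leq_add //; rewrite -subSn // subSS leq_sub2l //.
Qed.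

Local Notation Xc j := (alt_coef l (@young_char F n j)).

Lemma alt_coef_char j : Xc j = (h j)^-1 * alt_coef l (fun g => bform (c j) (R g)).
Proof. exact: alt_coefZ. Qed.

Lemma alt_coef_char_dom j : Xc j != 0 ->
  forall m, (sumn (take m lam) <= sumn (take m (parts j)))%N.
Proof.
rewrite alt_coef_char mulf_eq0 negb_or => /andP[_ nz] m.
have := alt_coef_young_dom charF0 (rcC (j := j)) nz m.
by rewrite psum_frobenius_exp leq_add2l card_row_lt ?parts_sum.
Qed.

(** A measure that strictly increases along dominance; it drives the downward induction below. *)
Let cum (j : intpart n) := (\sum_(m < n) sumn (take m (parts j)))%N.

Lemma take_parts_le (j : intpart n) m : (sumn (take m (parts j)) <= n)%N.
Proof.
rewrite -[X in (_ <= X)%N](parts_sum j).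
by rewrite -[in leqRHS](cat_take_drop m (parts j)) sumn_cat leq_addr.
Qed.

Let cum_lt (i j : intpart n) : i != j ->
  (forall m, (sumn (take m (parts i)) <= sumn (take m (parts j)))%N) ->
    (cum i < cum j)%N.
Proof.
move=> ij dom; rewrite ltn_neqAle leq_sum ?andbT => [|m _]; last exact: dom.
apply: contra ij; rewrite /cum.
have [_ ->] := leqif_sum (fun (m : 'I_n) (_ : true) => leqif_eq (dom m)).
move=> /forallP e; apply/eqP/parts_inj => m; have [mn|nm] := ltnP m n.
  exact/eqP/(e (Ordinal mn)).
by rewrite !take_oversize ?size_map ?size_tuple // !parts_sum.
Qed.

(** Expand [psi], built from the row sum of j. If its coefficient is nonzero, the Pieri bound
    applies. If not, the term of j cancels against that of some other i dominating j, and the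
    induction hypothesis for i suffices. *)
Lemma alt_coef_char_dom_rev j : Xc j != 0 ->
  forall m, (sumn (take m (parts j)) <= sumn (take m lam))%N.
Proof.
have [b] := ubnP (n * n - cum j)%N; elim: b j => // b IH j jb nz.
pose psi (g : 'S_n) := bform (rsum R (row j)) (R g).
have psiJ s u : psi (s ^ u)%g = psi s by rewrite /psi bformJ.
have E := alt_coef_sum l (class_fun_expansion charF0 C_type psiJ).
have mE i : young_mult i psi = (h i)^-1 * bform (c i) (rsum R (row j)).
  by rewrite young_mult_bform young_gr rsum_gr bform_sym.
have [z|psi_nz] := eqVneq (alt_coef l psi) 0; last first.
  move=> m; have := @alt_coef_rsum_dom F n k charF0 (row j) (parts j) l _ _
    frobenius_exp_sdecr psi_nz m.
  rewrite psum_frobenius_exp leq_add2l; apply => [x|i].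
    by rewrite reshape_indexP ?parts_sum.
  by rewrite card_row_eq ?parts_sum.
(* The coefficient of j in [psi] is [#|stab (row j)|], nonzero in characteristic 0, so another term
   must be nonzero. *)
have [i ij] : exists2 i, i != j & young_mult i psi * Xc i != 0.
  apply/exists_inP; apply: contraT => /exists_inPn N.
  move: E; rewrite z (bigD1 j) //= big1 ?addr0 => [/esym/eqP|i ij]; last first.
    by apply/eqP; have := N i ij; rewrite negbK.
  rewrite mulf_eq0 (negPf nz) orbF mE.
  rewrite (bform_young_rsum charF0 (@rcI j) (rcC (j := j))).
  by rewrite mulrA mulVf // mul1r (negPf (natF_neq0 charF0 (card_stab_gt0 _))).
rewrite mulf_eq0 negb_or mE mulf_eq0 negb_or => /andP[/andP[_ bi] Xi].
have dom m : (sumn (take m (parts j)) <= sumn (take m (parts i)))%N.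
  have := bform_young_rsum_dom charF0 (rcC (j := i)) bi m.
  by rewrite !card_row_lt ?parts_sum.
move=> m; apply: leq_trans (dom m) _; apply: IH Xi m.
rewrite eq_sym in ij; have lt := cum_lt ij dom.
have le : (cum i <= n * n)%N.
  rewrite -[X in (_ <= X * _)%N]card_ord -sum_nat_const; apply: leq_sum => m _.
  exact: take_parts_le.
rewrite -ltnS (leq_trans _ jb) // ltnS ltn_sub2l // (leq_trans lt) //.
Qed.

Lemma lam_part : exists j : intpart n,
  forall m, sumn (take m (parts j)) = sumn (take m lam).
Proof.
have [j e] := intpart_of_seq lam_sorted lam_sum; exists j => m.
by rewrite !sumn_take_nth; apply: eq_bigr => i _; apply: e.
Qed.

Lemma alt_coef_frobenius (chi : 'S_n -> F) : (forall s u, chi (s ^ u)%g = chi s) ->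
  alt_coef l chi
  = (hook F (@rowf n lam) (@colf n lam))^-1
    * \sum_g young_coef F (@rowf n lam) (@colf n lam) g * chi g.
Proof.
move=> chiJ; have [j je] := lam_part.
have rE x : row j x = rowf lam x by apply: reshape_index_eq; rewrite ?parts_sum.
have cE x : col j x = colf lam x by apply: reshape_offset_eq; rewrite ?parts_sum.
have st (f g : 'I_n -> nat) : f =1 g -> stab f = stab g.
  by move=> fg; apply/setP => p; rewrite !inE; apply: eq_forallb => x; rewrite !fg.
have yE g : young_coef F (@rowf n lam) (@colf n lam) g =
  young_coef F (row j) (col j) g.
  by rewrite /young_coef (st _ _ rE) (st _ _ cE).
have hE : hook F (@rowf n lam) (@colf n lam) = h j.
  rewrite /hook (st _ _ rE) (st _ _ cE); apply: eq_bigr => p _;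
    apply: eq_bigr => q _.
  by rewrite yE.
rewrite (alt_coef_sum l (class_fun_expansion charF0 C_type chiJ)).
rewrite (bigD1 j) //= big1 ?addr0 => [|i ij]; last first.
  rewrite (_ : Xc i = 0) ?mulr0 //; apply/eqP; apply: contraNT ij => nz.
  apply/eqP/parts_inj => m; rewrite je; apply/eqP.
  by rewrite eqn_leq alt_coef_char_dom_rev // alt_coef_char_dom.
rewrite alt_coef_char frobenius_expE.
rewrite (alt_coef_young_eq charF0 (@rcI j) (rcC (j := j))) => [|x];
  last by rewrite ffunE /= rE.
rewrite mulVf // mulr1 hE; congr (_ * _).
by apply: eq_bigr => g _; rewrite yE.
Qed.

End Frobenius.

(** * Multiplicity of a Specht module *)

Section Multiplicity.

Variables (F : fieldType) (n : nat) (lam : seq nat).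
Hypothesis charF0 : [pchar F] =i pred0.
Hypotheses (lam_sorted : sorted geq lam) (lam_sum : sumn lam = n).

Local Notation Sn := [set: 'S_n].
Local Notation R := (regular_repr F Sn).
Local Notation rw := (@rowf n lam).
Local Notation cl := (@colf n lam).
Local Notation c := (young R rw cl).
Local Notation cf := (young_coef F rw cl).
Local Notation h := (hook F rw cl).
Local Notation v := (young_symmetrizer F n lam).
Local Notation M := (cyclic_mx R v).
Local Notation modM := (cyclic_mx_module R v).

Let rcI := @row_col_inj n lam.
Let rcC := row_col_closed lam_sorted lam_sum.
Let two : (2%:R : F) != 0 := char2 charF0.
Let hN0 : h != 0 := hook_neq0 charF0 rcI rcC.

Let e1 : 'rV[F]_#|Sn| := delta_mx 0 (gring_index Sn 1%g).

Lemma young_symmetrizerE : v = e1 *m c.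
Proof.
rewrite youngE mulmx_sumr /young_symmetrizer [LHS]exchange_big;
  apply: eq_bigr => q _.
rewrite mulmx_sumr; apply: eq_bigr => p _; rewrite -scalemxAr; congr (_ *: _).
by rewrite -rowE rowK gring_indexK ?inE // mul1g.
Qed.

Lemma young_symmetrizer_neq0 : v != 0.
Proof.
apply/eqP => /matrixP/(_ 0 (gring_index Sn 1%g)); rewrite young_symmetrizerE.
by rewrite -rowE [LHS]mxE [RHS]mxE young_reg1 //; apply/eqP/oner_neq0.
Qed.

Lemma young_symmetrizer_young : v *m c = h *: v.
Proof.
rewrite young_symmetrizerE -(mulmxA e1 c c).
by rewrite (young_sqr R two rcI rcC) -scalemxAr.
Qed.

(** A vector of the module is v times group elements, and c g c is a multiple of c. *)
Lemma specht_mul_young m (w : 'M[F]_(m, _)) : (w <= M)%MS -> (w *m c <= v)%MS.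
Proof.
move=> wM; apply/row_subP => i; rewrite row_mul.
have /cyclic_mxP[A /envelop_mxP[a ->] ->] := submx_trans (row_sub i w) wM.
rewrite mulmx_sumr mulmx_suml summx_sub // => g _.
rewrite -scalemxAr -scalemxAl scalemx_sub // young_symmetrizerE.
rewrite -(mulmxA e1 c) -(mulmxA e1 _ c).
by rewrite (young_rho_young R two rcI rcC) -scalemxAr scalemx_sub.
Qed.

Lemma mxmodule_young d (W : mx_representation F Sn d) (U : 'M_d) m (w : 'M_(m, d)) :
  mxmodule W U -> (w <= U)%MS -> (w *m young W rw cl <= U)%MS.
Proof.
move=> modU wU; rewrite youngE mulmx_sumr summx_sub // => q _.
rewrite mulmx_sumr summx_sub // => p _; rewrite -scalemxAr scalemx_sub //.
by rewrite (mxmodule_trans modU) ?inE.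
Qed.

Lemma Maschke_Sn d (W : mx_representation F Sn d) : mx_completely_reducible W 1%:M.
Proof.
apply: mx_Maschke_pchar; rewrite /pgroup; apply/pnatP => [|p pr _].
  exact: cardG_gt0.
by rewrite inE /= charF0.
Qed.

(** Take a complement W of U and write v = x + y. Then x c - h x = h y - y c lies in both U and W,
    so x c = h x, while x c is a multiple of v. Either v lies in U, or x = 0 and U would lie in
    W. *)
Lemma specht_simple : mxsimple R M.
Proof.
split; [exact: modM | by rewrite cyclic_mx_eq0 young_symmetrizer_neq0 |].
move=> U modU sUM nzU.
have [W modW defM dx] := mx_reducibleS modM (submx1 M) (@Maschke_Sn _ R) modU sUM.
have := cyclic_mx_id R v; rewrite -defM => /sub_addsmxP[[u1 u2] /= vE].
set x := u1 *m U in vE; set y := u2 *m W in vE.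
have xU : (x <= U)%MS by apply: submxMl.
have yW : (y <= W)%MS by apply: submxMl.
have E : x *m c - h *: x = h *: y - y *m c.
  apply/eqP; rewrite subr_eq addrAC eq_sym subr_eq -scalerDr -mulmxDl addrC -vE.
  by rewrite young_symmetrizer_young.
have zero : x *m c - h *: x = 0.
  apply/eqP; rewrite -submx0 -(mxdirect_addsP dx) sub_capmx {2}E.
  by rewrite !addmx_sub ?eqmx_opp ?scalemx_sub ?mxmodule_young.
have [x0|xN0] := eqVneq x 0.
  case/negP: nzU; rewrite -submx0 -(mxdirect_addsP dx) sub_capmx submx_refl /=.
  by rewrite (submx_trans sUM) // cyclic_mx_sub // vE x0 add0r.
apply: cyclic_mx_sub => //; have := specht_mul_young (submx_trans xU sUM).
move/eqP: zero; rewrite subr_eq0 => /eqP ->; move/sub_rVP => [b xb].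
have b0 : b != 0.
  apply: contra_neq xN0 => b0; apply: (scalerI hN0).
  by rewrite xb b0 !scale0r scaler0.
have -> : v = (b^-1 * h) *: x by rewrite -scalerA xb scalerA mulVf // scale1r.
exact: scalemx_sub.
Qed.

Lemma val_submod_young (W : 'M[F]_#|Sn|) (modW : mxmodule R W) m
    (w : 'M_(m, \rank W)) :
  val_submod (w *m young (submod_repr modW) rw cl) = val_submod w *m c.
Proof.
rewrite !youngE !mulmx_sumr linear_sum; apply: eq_bigr => q _ /=.
rewrite !mulmx_sumr linear_sum; apply: eq_bigr => p _ /=.
by rewrite -!scalemxAr linearZ /= val_submodJ ?inE.
Qed.

Lemma rank_young_specht : \rank (young (specht F n lam) rw cl) = 1%N.
Proof.
set Y := young _ _ _; apply/eqP; rewrite eqn_leq; apply/andP; split.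
  have s : (Y <= in_submod M v)%MS.
    rewrite -val_submodS in_submodK ?cyclic_mx_id // -[Y]mul1mx val_submod_young.
    exact/specht_mul_young/val_submodP.
  exact: leq_trans (mxrankS s) (rank_leq_row _).
rewrite lt0n mxrank_eq0; apply/eqP => Y0.
have := val_submod_young modM (in_submod M v); rewrite -/Y Y0 mulmx0 linear0.
rewrite in_submodK ?cyclic_mx_id // young_symmetrizer_young => /esym/eqP.
by rewrite scaler_eq0 (negPf hN0) (negPf young_symmetrizer_neq0).
Qed.

Lemma trace_young_specht : \tr (young (specht F n lam) rw cl) = h.
Proof.
by rewrite (mxtrace_quasi_idem (young_sqr _ two rcI rcC)) rank_young_specht mulr1.
Qed.

(** A vector u with u c nonzero gives the map g |-> u g from the group algebra to S, which does not
    kill v. On the module generated by v it is a nonzero intertwiner of simple modules, hence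
    bijective. *)
Lemma rsim_specht d (S : mx_representation F Sn d) : mx_irreducible S ->
  young S rw cl != 0 -> mx_rsim S (specht F n lam).
Proof.
move=> irrS nzY; apply: mx_rsim_sym.
have [i ui] : exists i, row i (young S rw cl) != 0.
  apply/existsP; apply: contraNT nzY => /existsPn N; apply/eqP/row_matrixP => i.
  by rewrite row0; apply/eqP; have := N i; rewrite negbK.
pose u : 'rV[F]_d := delta_mx 0 i.
pose T : 'M[F]_(#|Sn|, d) := \matrix_j (u *m S (enum_val j)).
have RT g : R g *m T = T *m S g.
  apply/row_matrixP => j; rewrite !row_mul !rowK -rowE rowK.
  by rewrite gring_indexK ?inE // rhoM mulmxA.
have yT : c *m T = T *m young S rw cl.
  rewrite !youngE mulmx_suml mulmx_sumr; apply: eq_bigr => q _.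
  rewrite mulmx_suml mulmx_sumr; apply: eq_bigr => p _.
  by rewrite -scalemxAl -scalemxAr RT.
have vT : v *m T != 0.
  rewrite young_symmetrizerE -(mulmxA e1 c) yT mulmxA -rowE rowK.
  by rewrite gring_indexK ?inE // rho1 mulmx1 -rowE.
have irrV : mx_irreducible (specht F n lam) by apply/submod_mx_irr/specht_simple.
pose B : 'M[F]_(\rank M, d) := val_submod 1%:M *m T.
have SB g : specht F n lam g *m B = B *m S g.
  rewrite /B -[RHS]mulmxA -RT [RHS]mulmxA -(val_submodJ modM) ?inE // mul1mx.
  by rewrite [in RHS]val_submodE mulmxA.
have B0 : B != 0.
  apply: contra_neq vT => B0.
  by rewrite -(in_submodK (cyclic_mx_id R v)) val_submodE -mulmxA -/B B0 mulmx0.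
have freeB : row_free B.
  rewrite -kermx_eq0; apply: contraNT B0 => kerN0; have [_ _ simV] := irrV.
  rewrite -submx0; apply: submx_trans (_ : (1%:M *m B <= 0)%MS);
    first by rewrite mul1mx.
  have sK : (1%:M <= kermx B)%MS.
    apply: simV (submx1 _) kerN0; apply/mxmoduleP => g _; apply/sub_kermxP.
    by rewrite -mulmxA SB mulmxA mulmx_ker mul0mx.
  by rewrite (sub_kermxP sK) sub0mx.
have fullB : row_full B.
  rewrite -sub1mx; have [_ _ simS] := irrS.
  rewrite -(genmxE B); apply: simS (submx1 _) _;
    last by rewrite -submx0 genmxE submx0.
  rewrite (eqmx_module _ (genmxE B)); apply/mxmoduleP => g _.
  by rewrite -SB submxMl.
exists B => //.
by rewrite -(eqP freeB) (eqP fullB).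
Qed.

Lemma mxtrace_young d (W : mx_representation F Sn d) :
  \tr (young W rw cl) = \sum_g cf g * \tr (W g).
Proof.
by rewrite young_gr raddf_sum; apply: eq_bigr => g _; rewrite /= mxtraceZ.
Qed.

(** The trace is additive over simple summands. Those isomorphic to the Specht module contribute h,
    and c kills the others by [rsim_specht]. *)
Lemma is_multiplicity_trace d (W : mx_representation F Sn d) m :
  is_multiplicity (specht F n lam) W m -> \tr (young W rw cl) = m%:R * h.
Proof.
case=> s [U [modU [J [simU dxU defU JP <-]]]].
have trU i : \tr (young (submod_repr (modU i)) rw cl) = (i \in J)%:R * h.
  have [iJ|iJ] := boolP (i \in J).
    rewrite mul1r -trace_young_specht !mxtrace_young; apply: eq_bigr => g _.
    by rewrite (mxtrace_rsim (proj1 (JP i) iJ)) ?inE.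
  rewrite mul0r (_ : young _ _ _ = 0) ?mxtrace0 //; apply/eqP.
  apply: contraNT iJ => nz; apply/JP/rsim_specht => //; exact/submod_mx_irr.
transitivity (\sum_i \tr (young (submod_repr (modU i)) rw cl)).
  under eq_bigr do rewrite mxtrace_young.
  rewrite mxtrace_young exchange_big; apply: eq_bigr => g _ /=.
  rewrite -mulr_sumr; congr (_ * _).
  rewrite (mxtrace_dsum_mod modU (mxmodule1 W)) ?inE // mxtrace_submod1 ?inE //.
under eq_bigr do rewrite trU.
by rewrite -mulr_suml -natr_sum -sum1_card [in RHS]big_mkcond /=; congr (_%:R * _).
Qed.

Lemma is_multiplicity_exists d (W : mx_representation F Sn d) :
  exists m, is_multiplicity (specht F n lam) W m.
Proof.
(* The decomposition into simple modules is only available for proving a boolean goal, hence the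
   detour through a contradiction. *)
apply: Classical_Prop.NNPP => N.
suff : false by [].
apply: (mx_reducible_semisimple (mxmodule1 W) (@Maschke_Sn _ W)) =>
  -[I U /= simU defU dxU].
case: N.
pose U' (i : 'I_#|I|) := U (enum_val i).
have modU i : mxmodule W (U' i) by have [] := simU (enum_val i).
pose isS i : bool := if excluded_middle_informative
  (mx_rsim (submod_repr (modU i)) (specht F n lam)) then true else false.
have bij : {on [pred _ : I | true], bijective (enum_val : 'I_#|I| -> I)}.
  by exists enum_rank => i _; rewrite ?enum_valK ?enum_rankK.
have sumU : (\sum_i U' i)%MS = (\sum_i U i)%MS by rewrite [RHS](reindex _ bij).
exists #|[set i | isS i]|, #|I|, U', modU, [set i | isS i]; split => //.
- by move=> i; apply: simU.
- move: dxU; rewrite !mxdirectE /= sumU => /eqP ->.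
  by rewrite [X in X == _](reindex _ bij).
- by rewrite sumU.
- by move=> i; rewrite inE /isS; case: excluded_middle_informative.
Qed.

Lemma multiplicity_trace d (W : mx_representation F Sn d) :
  (multiplicity (specht F n lam) W)%:R = h^-1 * \sum_g cf g * \tr (W g).
Proof.
have /is_multiplicity_trace E : is_multiplicity (specht F n lam) W
    (multiplicity (specht F n lam) W) by exact: epsilon_spec
      (is_multiplicity_exists W).
by rewrite -mxtrace_young E mulrCA mulVf ?mulr1.
Qed.

End Multiplicity.

Theorem proposition7p2 (F : fieldType) (charF0 : [pchar F] =i pred0)
    (n k : nat) (lam : k.-tuple nat)
    (lam_sorted : sorted geq lam) (lam_sum : sumn lam = n)
    (C : intpart n -> 'S_n) (C_type : forall j, C j \in conj_class j) (r : nat) :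
  (multiplicity (specht F n lam) (Qrep F n r))%:R
  = (frobenius_bracket F k C r)@_(frobenius_exp lam).
Proof.
rewrite (multiplicity_trace charF0 lam_sorted lam_sum).
pose chi s := \tr (Qrep F n r s).
have chiJ s u : chi (s ^ u)%g = chi s.
  by rewrite /chi conjgE !rhoM mxtrace_mulC -mulmxA -rhoM mulgV rho1 mulmx1.
rewrite -(alt_coef_frobenius charF0 C_type lam_sorted lam_sum chiJ).
rewrite /frobenius_bracket mcoeffZ; congr (_ * _).
have -> := frobenius_sum (vandermonde_prod F k) C_type chiJ.
by rewrite raddf_sum; apply: eq_bigr => s _; rewrite /= mcoeffZ.
Qed.
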